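(* Let $M=(H;r_0,r_2,\rho_0,\rho_2)$ range over the proper edge-biregular maps supported by closed surfaces of Euler characteristic $\chi<0$ whose colour-preserving automorphism group $H=\langle r_0,r_2,\rho_0,\rho_2\rangle$ is isomorphic to the dihedral group $D_{2m}$ of order $2m$. Then $m$ is even, $m\ge 4$, and, up to duality and twinness, these maps are exactly those in the following list (where $V$ and $F$ are the numbers of vertices and faces; in each case $H\cong D_{2m}$ is the dihedral group of order $2m$ generated by the indicated pair(s) of involutions, and the indicated relations hold in $H$ and express the remaining generators): (1) type $(2m,2m)$: $H=\langle r_0,\rho_0\rangle=\langle r_2,\rho_2\rangle$, with $r_0r_2=\rho_0\rho_2=(r_0\rho_0)^{m/2}=(r_2\rho_2)^{m/2}$; no further condition on $m$; $\chi=2-m$, $V=1$, $F=1$; the map is fully regular. (2) type $(m,m)$: $H=\langle r_2,\rho_0\rangle=\langle r_0,\rho_2\rangle$, with $r_0r_2=\rho_0\rho_2=(r_2\rho_0)^{m/2}=(r_0\rho_2)^{m/2}$; condition: $m/2$ is odd; $\chi=4-m$, $V=2$, $F=2$; the map is fully regular. (3) type $(2m,4)$: $H=\langle r_2,\rho_2\rangle$, with $r_0r_2=\rho_0=(r_2\rho_2)^{m/2}$; no further condition on $m$; $\chi=\tfrac12(2-m)$, $V=1$, $F=\tfrac m2$; the map is not fully regular. (4) type $(m,4)$: $H=\langle r_0,\rho_2\rangle$, with $r_0r_2=\rho_0=(r_0\rho_2)^{m/2}$; condition: $m/2$ is odd; $\chi=\tfrac12(4-m)$, $V=2$, $F=\tfrac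 m2$; the map is not fully regular.
   Context: A map is an embedding of a connected graph in a surface such that each face is homeomorphic to an open disc; semi-edges (edges with only one end attached to a vertex, the other end dangling) are in general allowed. An alternate-edge-colouring of a map is a colouring of its edges with two colours (shaded, unshaded) such that consecutive edges around every face, and consecutive edges around every vertex, have different colours. Flags are the faces of the barycentric subdivision; a corner is the pair of flags of one face which meet at a corner of that face, and consists of one flag of each colour. A map with an assigned alternate-edge-colouring is edge-biregular if its group $H$ of colour-preserving (and structure-preserving) automorphisms acts regularly on the set of corners. Fixing a marked corner, $H$ is generated by involutions $r_0,r_2,\rho_0,\rho_2$ taking the marked corner to its neighbour respectively along the shaded edge, across the shaded edge, along the unshaded edge, across the unshaded edge. The map is written $(H;r_0,r_2,\rho_0,\rho_2)$ and has type $(k,l)$ (vertex valency $k$, face length $l$), where $$H=\langle r_0,r_2,\rho_0,\rho_2\mid r_0^2,r_2^2,\rho_0^2,\rho_2^2,(r_0r_2)^2,(\rho_0\rho_2)^2,(r_2\rho_2)^{k/2},(r_0\rho_0)^{l/2},\dots\rangle ,$$ and the orders of $r_2\rho_2$ and $r_0\rho_0$ are $k/2$ and $l/2$. Conversely such a group with these generators determines the map up to isomorphism; two such maps are isomorphic iff matching the four generators in order extends to a group isomorphism. The map is proper if it has no semi-edges, i.e. $r_0\ne r_2$ and $\rho_0\neq\rho_2$. The twin of $(H;r_0,r_2,\rho_0,\rho_2)$ is $(H;\rho_0,\rho_2,r_0,r_2)$ (colours switched); its dual is $(H;r_2,r_0,\rho_2,\rho_0)$ (vertices and faces interchanged). The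 map is fully regular if its full automorphism group (allowing colour-reversing automorphisms) is transitive on flags; equivalently there is an automorphism of $H$ interchanging $r_0\leftrightarrow\rho_0$ and $r_2\leftrightarrow\rho_2$. Closed surfaces are compact, connected and without boundary (orientable or not). *)

(* Defs.v *)
From mathcomp Require Import all_boot all_order all_algebra.
From mathcomp Require Import all_fingroup all_solvable.

Set Implicit Arguments.
Unset Strict Implicit.
Unset Printing Implicit Defensive.

Import GroupScope.

(* A map on a closed surface together with an alternate-edge-colouring, given *)
(* by its finite set of flags.  The involutions t0, t1, t2 take a flag to the *)
(* adjacent one along the edge (same edge and face), round the corner (same   *)
(* vertex and face), and across the edge (same edge and vertex).  Having no   *)
(* fixed points means that the surface has no boundary, transitivity that it  *)
(* is connected.  Semi-edges are the orbits on which t0 and t2 agree.         *)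
(* Edges that are consecutive at a vertex or at a face share a corner, so the *)
(* colouring is alternating when t1 reverses the colour of a flag.            *)
Record cmap : Type := CMap {
  flag : finType;
  t0 : {perm flag};
  t1 : {perm flag};
  t2 : {perm flag};
  shaded : {set flag};
  t0K : involutive t0;
  t1K : involutive t1;
  t2K : involutive t2;
  t0_neq : forall x, t0 x != x;
  t1_neq : forall x, t1 x != x;
  t2_neq : forall x, t2 x != x;
  t02C : forall x, t0 (t2 x) = t2 (t0 x);
  cmap_trans : [transitive <<[set t0; t1; t2]>>, on [set: flag] | 'P];
  shaded_t0 : forall x, (t0 x \in shaded) = (x \in shaded);
  shaded_t2 : forall x, (t2 x \in shaded) = (x \in shaded);
  shaded_t1 : forall x, (t1 x \in shaded) = (x \notin shaded)
}.

Section CMapTheory.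

Variable M : cmap.

Definition vertices : {set {set flag M}} :=
  orbit 'P <<[set t1 M; t2 M]>> @: [set: flag M].
Definition edges : {set {set flag M}} :=
  orbit 'P <<[set t0 M; t2 M]>> @: [set: flag M].
Definition faces : {set {set flag M}} :=
  orbit 'P <<[set t0 M; t1 M]>> @: [set: flag M].

(* The Euler characteristic of the surface when there are no semi-edges       *)
(* (otherwise the semi-edges should not be counted).                          *)
Definition euler : int :=
  ((#|vertices|%:Z - #|edges|%:Z) + #|faces|%:Z)%R.

(* Each of the k edge-ends at a vertex, and each of the l edge-sides of a     *)
(* face, carries two of its flags.                                            *)
Definition has_type (k l : nat) : Prop :=
  (forall v, v \in vertices -> #|v| = (2 * k)%N) /\
  (forall f, f \in faces -> #|f| = (2 * l)%N).

Definition proper_map : Prop := forall x : flag M, t0 M x != t2 M x.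

Definition corner (x : flag M) : {set flag M} := [set x; t1 M x].
Definition corners : {set {set flag M}} := corner @: [set: flag M].

(* The automorphisms of the underlying map: since the map is connected they   *)
(* either preserve or reverse the colours.                                    *)
Definition full_aut : {group {perm flag M}} :=
  'C([set t0 M; t1 M; t2 M])%G.

Definition colour_aut : {group {perm flag M}} :=
  'N_full_aut(shaded M | 'P)%G.

Definition edge_biregular : Prop :=
  [transitive colour_aut, on corners | 'P^*] /\
  (forall C, C \in corners -> 'C_colour_aut[C | 'P^*] = 1).

Definition fully_regular : Prop :=
  [transitive full_aut, on [set: flag M] | 'P].

(* The map can be written (H; r0, r2, rho0, rho2) where H = colour_aut, for   *)
(* some choice of the marked corner; x is the shaded flag of that corner, so  *)
(* t1 x is its unshaded flag.                                                 *)
Definition written_as (r0 r2 rho0 rho2 : {perm flag M}) : Prop :=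
  exists2 x, x \in shaded M &
    [/\ [/\ r0 \in colour_aut, r2 \in colour_aut,
            rho0 \in colour_aut & rho2 \in colour_aut],
        r0 @: corner x = corner (t0 M x),
        r2 @: corner x = corner (t2 M x),
        rho0 @: corner x = corner (t0 M (t1 M x))
      & rho2 @: corner x = corner (t2 M (t1 M x))].

End CMapTheory.

Arguments written_as M r0 r2 rho0 rho2 : clear implicits.

Definition cmap_iso (M N : cmap) : Prop :=
  exists f : flag M -> flag N,
    [/\ bijective f,
        forall x, f (t0 M x) = t0 N (f x),
        forall x, f (t1 M x) = t1 N (f x),
        forall x, f (t2 M x) = t2 N (f x)
      & forall x, (f x \in shaded N) = (x \in shaded M)].

Section DualTwin.

Variable M : cmap.

Fact dual_t02C x : t2 M (t0 M x) = t0 M (t2 M x).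
Proof. by rewrite t02C. Qed.

Fact dual_trans : [transitive <<[set t2 M; t1 M; t0 M]>>, on setT | 'P].
Proof.
rewrite (_ : [set t2 M; t1 M; t0 M] = [set t0 M; t1 M; t2 M]).
  exact: cmap_trans.
by apply/setP=> g; rewrite !inE orbC orbA orbAC.
Qed.

Definition dual_map : cmap :=
  CMap (@t2K M) (@t1K M) (@t0K M) (@t2_neq M) (@t1_neq M) (@t0_neq M)
    dual_t02C dual_trans (@shaded_t2 M) (@shaded_t0 M) (@shaded_t1 M).

Fact twin_t0 x : (t0 M x \in ~: shaded M) = (x \in ~: shaded M).
Proof. by rewrite !inE shaded_t0. Qed.

Fact twin_t2 x : (t2 M x \in ~: shaded M) = (x \in ~: shaded M).
Proof. by rewrite !inE shaded_t2. Qed.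

Fact twin_t1 x : (t1 M x \in ~: shaded M) = (x \notin ~: shaded M).
Proof. by rewrite !inE shaded_t1. Qed.

Definition twin_map : cmap :=
  CMap (@t0K M) (@t1K M) (@t2K M) (@t0_neq M) (@t1_neq M) (@t2_neq M)
    (@t02C M) (@cmap_trans M) twin_t0 twin_t2 twin_t1.

End DualTwin.

Inductive list_entry : Type := Row1 | Row2 | Row3 | Row4.

Definition row_cond (i : list_entry) (m : nat) : bool :=
  [&& ~~ odd m, 4 <= m &
    match i with Row1 | Row3 => true | Row2 | Row4 => odd (m %/ 2) end].

Definition row_rel (i : list_entry) (m : nat) (gT : finGroupType) (H : {set gT})
    (r0 r2 rho0 rho2 : gT) : Prop :=
  match i with
  | Row1 => [/\ H = <<[set r0; rho0]>>, H = <<[set r2; rho2]>>,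
      r0 * r2 = rho0 * rho2, rho0 * rho2 = (r0 * rho0) ^+ (m %/ 2)
    & (r0 * rho0) ^+ (m %/ 2) = (r2 * rho2) ^+ (m %/ 2)]
  | Row2 => [/\ H = <<[set r2; rho0]>>, H = <<[set r0; rho2]>>,
      r0 * r2 = rho0 * rho2, rho0 * rho2 = (r2 * rho0) ^+ (m %/ 2)
    & (r2 * rho0) ^+ (m %/ 2) = (r0 * rho2) ^+ (m %/ 2)]
  | Row3 => [/\ H = <<[set r2; rho2]>>,
      r0 * r2 = rho0 & rho0 = (r2 * rho2) ^+ (m %/ 2)]
  | Row4 => [/\ H = <<[set r0; rho2]>>,
      r0 * r2 = rho0 & rho0 = (r0 * rho2) ^+ (m %/ 2)]
  end.

(* Type, Euler characteristic, numbers of vertices and faces, and full        *)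
(* regularity; m is even, so the integer divisions are exact.                 *)
Definition row_data (i : list_entry) (m : nat) (M : cmap) : Prop :=
  match i with
  | Row1 => [/\ has_type M (2 * m) (2 * m), euler M = (2 - m%:Z)%R,
      #|vertices M| = 1%N, #|faces M| = 1%N & fully_regular M]
  | Row2 => [/\ has_type M m m, euler M = (4 - m%:Z)%R,
      #|vertices M| = 2, #|faces M| = 2 & fully_regular M]
  | Row3 => [/\ has_type M (2 * m) 4, euler M = ((2 - m%:Z) %/ 2)%Z,
      #|vertices M| = 1%N, #|faces M| = (m %/ 2)%N & ~ fully_regular M]
  | Row4 => [/\ has_type M m 4, euler M = ((4 - m%:Z) %/ 2)%Z,
      #|vertices M| = 2, #|faces M| = (m %/ 2)%N & ~ fully_regular M]
  end.

(* M = (H; r0, r2, rho0, rho2) is a map of row i of the list, with H dihedral *)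
(* of order 2m.  'D_n is the dihedral group of order n only for even n >= 4;  *)
(* here row_cond gives m >= 4.                                                *)
Definition listed (i : list_entry) (m : nat) (M : cmap)
    (r0 r2 rho0 rho2 : {perm flag M}) : Prop :=
  [/\ edge_biregular M, colour_aut M \isog 'D_(2 * m),
      written_as M r0 r2 rho0 rho2, row_cond i m
    & row_rel i m (colour_aut M) r0 r2 rho0 rho2].

Arguments listed i m M r0 r2 rho0 rho2 : clear implicits.

(* Main.v *)
(** In a dihedral group of order 2m with m >= 3, an involution that is not
    central lies outside the cyclic subgroup of index 2, so that for two distinct
    commuting involutions g and h one of g, h, gh is the central involution z
    (and m is even).  Applied to (r0, r2) and to (rho0, rho2) this gives nine
    cases.  Those in which z is among both pairs have Euler characteristic >= 0;
    in the others H is generated by z and two further involutions a and b.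
    Either H = <a, b> and z = (ab)^(m/2), or <a, b> has index 2, m/2 is odd and
    (za)b generates the rotations: this is the dichotomy between rows 1 and 2,
    and between rows 3 and 4.

    The shaded flags of an edge-biregular map are a regular orbit of H, so that
    its vertices and faces correspond to the cosets of <r2, rho2> and of
    <r0, rho0>, and a group isomorphism matching the generators gives a map
    isomorphism. *)

Require Import Defs.
From mathcomp Require Import all_boot all_order all_algebra.
From mathcomp Require Import all_fingroup all_solvable.
From mathcomp Require Import zify.

Set Implicit Arguments.
Unset Strict Implicit.
Unset Printing Implicit Defensive.

Import GroupScope.

(** * Involutions and dihedral groups *)

Section Involutions.

Variable gT : finGroupType.
Implicit Types (a b z : gT) (H K : {group gT}).

Lemma order2P a : reflect (a != 1 /\ a * a = 1) (#[a] == 2).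
Proof.
apply: (iffP eqP) => [oa | [a1 aa]].
  by rewrite -order_gt1 oa -(expg_order a) oa expgS expg1.
by apply: nt_prime_order => //; rewrite expgS expg1.
Qed.

Lemma order2K a : #[a] = 2 -> a * a = 1.
Proof. by case/eqP/order2P. Qed.

Lemma order2V a : #[a] = 2 -> a^-1 = a.
Proof. by move/order2K/eqP; rewrite -eq_invg_mul => /eqP. Qed.

Lemma gen_set2P H a b : a \in H -> b \in H -> <<[set a; b]>> \subset H.
Proof. by move=> Ha Hb; rewrite gen_subG subUset !sub1set Ha. Qed.

(** The involution [a] inverts [a * b], so the group is [<[a * b]> * <[a]>], and the factors meet
    trivially. The case [a = b] is included. *)
Lemma card_gen_involutions a b : #[a] = 2 -> #[b] = 2 ->
  #|<<[set a; b]>>| = (2 * #[a * b])%N.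
Proof.
move=> oa ob; have aK := order2K oa; have bK := order2K ob.
have aV := order2V oa; have bV := order2V ob.
have nab : <[a]> \subset 'N(<[a * b]>).
  rewrite norms_cycle (_ : _ ^ a = (a * b)^-1) ?groupV ?cycle_id //.
  by rewrite conjgE invMg aV bV !mulgA aK mul1g.
have -> : <<[set a; b]>> = <[a * b]> * <[a]>.
  rewrite -norm_joinEr //; apply/eqP; rewrite eqEsubset; apply/andP; split.
    have Ga : a \in <[a * b]> <*> <[a]>.
      by rewrite (subsetP (joing_subr _ _)) ?cycle_id.
    apply: gen_set2P; rewrite // -{1}[b](mulKg a) groupM ?groupV //.
    by rewrite (subsetP (joing_subl _ _)) ?cycle_id.
  by rewrite join_subG !cycle_subG groupM ?mem_gen ?set21 ?set22.
rewrite TI_cardMg -?orderE ?oa 1?mulnC // setIC prime_TIg -?orderE ?oa //.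
rewrite cycle_subG; apply/negP => Ca.
(* If [a] is a power of [a * b], so is [b]; a cyclic group has one subgroup of order 2, so [a = b]
   and [<[a * b]>] is trivial. *)
have Cb : b \in <[a * b]> by rewrite -{1}[b](mulKg a) groupM ?groupV ?cycle_id.
have /eqP : <[a]> == <[b]>.
  by rewrite (eq_subG_cyclic (cycle_cyclic (a * b))) ?cycle_subG // -!orderE oa ob.
move/setP/(_ a); rewrite cycle_id cycle2g // !inE => /esym/orP[/eqP a1 | /eqP ab].
  by move: oa; rewrite a1 order1.
by move: Ca oa; rewrite -ab aK => /cycleP[i ->]; rewrite expg1n order1.
Qed.

End Involutions.

(** * Rotations, reflections and the central involution of a dihedral group *)

Section Dihedral.

Variables (gT : finGroupType) (H : {group gT}) (m : nat).
Hypotheses (m_gt1 : 1 < m) (dihH : H \isog 'D_(2 * m)).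

Lemma card_isog_dihedral : #|H| = (2 * m)%N.
Proof. by rewrite (card_isog dihH) mul2n card_dihedral. Qed.

(** [c] generates the rotations; the elements outside [<[c]>] are the reflections [c ^+ i * y] of
    the standard presentation. *)
Lemma dihedral_rotation : exists2 c, c \in H & #[c] = m /\
  {in H :\: <[c]> &, forall g h, g * h \in <[c]> /\ g * g = 1}.
Proof.
have := isog_hom dihH; rewrite mul2n (Grp_dihedral m_gt1) => /existsP[[c y]] /=.
case/eqP => defH cm y2 cy.
have nyc : <[y]> \subset 'N(<[c]>) by rewrite norms_cycle cy groupV cycle_id.
rewrite norm_joinEr // in defH.
have Hc : c \in H by rewrite -defH -{1}(mulg1 c) mem_mulg ?cycle_id ?group1.
(* The relation [c ^+ m = 1] bounds the order above; it is bounded below because [<[c]> * <[y]>] has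
   [2 * m] elements and [#[y] <= 2]. *)
have oc : #[c] = m.
  apply/eqP; rewrite eqn_leq dvdn_leq ?(ltnW m_gt1) ?order_dvdn ?cm //=.
  rewrite -(leq_pmul2l (isT : 0 < 2)) -card_isog_dihedral -defH mulnC.
  rewrite (leq_trans (dvdn_leq _ (dvdn_cardMg _ _))) ?muln_gt0 ?cardG_gt0 //.
  by rewrite -orderE leq_mul2l [#|_|](_ : _ = #[y]) // dvdn_leq ?orbT // order_dvdn y2.
exists c => //; split=> // g h.
have yy : y * y = 1 by [].
have yV : y^-1 = y by apply/eqP; rewrite eq_invg_mul yy.
have refl u : u \in H :\: <[c]> -> exists i, u = c ^+ i * y.
  case/setDP; rewrite -defH => /mulsgP[_ v /cycleP[i ->] /cycleP[j ->] ->] nc.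
  exists i; rewrite -(odd_double_half j) -mul2n expgD mulnC expgM expgAC in nc *.
  move: nc; rewrite y2 expg1n mulg1; case: (odd j) => //.
  by rewrite mulg1 mem_cycle.
have yc i : y * c ^+ i = c ^- i * y.
  by rewrite -expgVn -cy -conjXg conjgE yV -!mulgA yy mulg1.
move=> /refl[i ->] /refl[j ->].
have E k : c ^+ i * y * (c ^+ k * y) = c ^+ i * c ^- k.
  by rewrite -!mulgA (mulgA y) yc -mulgA yy mulg1.
by rewrite !E mulgV; split=> //; rewrite groupM ?groupV ?mem_cycle.
Qed.

(** The two involutions generate a Klein four-group, whose order divides [2 * m]. *)
Lemma dihedral_even g h : g \in H -> h \in H -> #[g] = 2 -> #[h] = 2 ->
  g != h -> commute g h -> ~~ odd m.
Proof.
move=> Hg Hh og oh gh cgh.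
have : #|<<[set g; h]>>| %| #|H| by rewrite cardSg ?gen_set2P.
have ogh : #[g * h] = 2.
  apply/eqP/order2P; rewrite -eq_invg_mul (order2V og) gh; split=> //.
  by rewrite {2}cgh mulgA -(mulgA g) order2K // mulg1 order2K.
rewrite card_gen_involutions // ogh card_isog_dihedral dvdn_pmul2l //.
by rewrite dvdn2.
Qed.

(** [z] is the half-turn [c ^+ (m %/ 2)], the only involution of [<[c]>]; all clauses but its order
    rest on this uniqueness. The last two locate [z] without mentioning [c]. *)
Lemma dihedral_central_involution : ~~ odd m -> exists z,
  [/\ z \in 'Z(H), #[z] = 2,
      {in H &, forall g h, #[g] = 2 -> #[h] = 2 -> g != h -> commute g h ->
         [\/ g = z, h = z | g * h = z]},
      forall K : {group gT}, K \subset H -> 4 %| #|K| -> z \in K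
    & 4 <= m -> {in H, forall g, #[g] = m -> g ^+ (m %/ 2) = z}].
Proof.
move=> even_m; have [c Hc [oc Cc]] := dihedral_rotation.
have m2 : 2 %| m by rewrite dvdn2.
pose z := c ^+ (m %/ 2).
have o_z : #[z] = 2.
  by rewrite orderXdiv oc ?dvdn_div // divnA // mulKn // ltnW.
have uniq_z u : u \in <[c]> -> #[u] = 2 -> u = z.
  move=> Cu ou; have /eqP: <[u]> == <[z]>.
    by rewrite (eq_subG_cyclic (cycle_cyclic c)) ?cycle_subG ?mem_cycle //
      -!orderE ou o_z.
  move/setP/(_ u); rewrite cycle_id cycle2g // !inE => /esym/orP[/eqP u1|/eqP //].
  by move: ou; rewrite u1 order1.
have notC g h : g \in H -> h \in H -> g \notin <[c]> -> h \notin <[c]> ->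
    g * h \in <[c]> /\ g * g = 1.
  by move=> *; apply: Cc; rewrite inE; apply/andP.
exists z; split=> //.
- apply/centerP; split=> [|h Hh]; first by rewrite groupX.
  have [/cycleP[i ->]|nCh] := boolP (h \in <[c]>); first exact: commuteX2.
  apply/commgP; rewrite -conjg_fix; apply/eqP/uniq_z; last by rewrite orderJ.
  have hz : h * z \notin <[c]> by rewrite groupMr ?mem_cycle.
  have [hzh _] := notC (h * z) h (groupM Hh (groupX _ Hc)) Hh hz nCh.
  have [_ hh] := notC h h Hh Hh nCh nCh.
  by rewrite conjgE mulgA (_ : h^-1 = h) //; apply/eqP; rewrite eq_invg_mul hh.
- move=> g h Hg Hh og oh gh cgh.
  have [Cg|nCg] := boolP (g \in <[c]>); first by constructor 1; apply: uniq_z.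
  have [Ch|nCh] := boolP (h \in <[c]>); first by constructor 2; apply: uniq_z.
  constructor 3; apply: uniq_z; first by have [] := notC g h Hg Hh nCg nCh.
  apply/eqP/order2P; rewrite -eq_invg_mul (order2V og) gh; split=> //.
  by rewrite {2}cgh mulgA -(mulgA g) order2K // mulg1 order2K.
- move=> K sKH K4; suff: 2 %| #|K :&: <[c]>|.
    by case/Cauchy=> // u /setIP[Ku Cu] ou; rewrite -(uniq_z u).
  rewrite dvdn2; apply/negP => odd_d.
  (* [K * <[c]>] lies in [H], so the rotations of [K] have index at most 2 in it. *)
  have d_le : #|K| <= 2 * #|K :&: <[c]>|.
    rewrite -(leq_pmul2r (ltnW m_gt1)) -{1}oc orderE mul_cardG mulnAC.
    rewrite leq_mul2r -card_isog_dihedral subset_leq_card ?orbT //.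
    by rewrite mul_subG ?cycle_subG.
  have : #|K :&: <[c]>| %| #|K| by rewrite cardSg ?subsetIl.
  (* An odd divisor of [j * 4] divides [j], so the rotations would form at most a quarter of [K],
     against the index bound. *)
  case/dvdnP: K4 => j oK; rewrite oK Gauss_dvdl; last first.
    by rewrite (coprime_pexpr _ 2 (isT : 0 < 2)) coprimen2.
  have j_gt0 : 0 < j by have := cardG_gt0 K; rewrite oK muln_gt0 => /andP[].
  by move/(dvdn_leq j_gt0); rewrite oK in d_le; lia.
- move=> m4 g Hg og; apply: uniq_z; last first.
    by rewrite orderXdiv og ?dvdn_div // divnA // mulKn // ltnW.
  (* Reflections have order at most 2, so an element of order at least 4 is a rotation. *)
  rewrite groupX //; apply: contraLR m4 => nCg.
  have [_ gg] := notC g g Hg Hg nCg nCg.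
  rewrite -ltnNge -og ltnS; apply: (@leq_trans 2) => //; apply: dvdn_leq => //.
  by rewrite order_dvdn expgS expg1 gg.
Qed.

End Dihedral.

(** * Classification of the generating quadruples *)

Section Classification.

Variables (gT : finGroupType) (H : {group gT}) (m : nat).
Hypotheses (m_gt1 : 1 < m) (dihH : H \isog 'D_(2 * m)).

Lemma gen_set4P (K : {group gT}) r0 r2 rho0 rho2 :
  r0 \in K -> r2 \in K -> rho0 \in K -> rho2 \in K ->
  <<[set r0; r2; rho0; rho2]>> \subset K.
Proof.
by move=> K0 K2 Kr0 Kr2; rewrite gen_subG !subUset !sub1set K0 K2 Kr0 Kr2.
Qed.

(** An odd power of [z] is [z]. With [n = m %/ 2] this recovers [z] from a twisted pair when the
    original pair misses it. *)
Lemma central_twist z a b n : z \in 'Z(H) -> #[z] = 2 -> a \in H -> b \in H ->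
    odd n -> (a * b) ^+ n = 1 ->
  (z * a * b) ^+ n = z.
Proof.
move=> /centerP[_ cz] oz Ha Hb odd_n abn.
rewrite -mulgA expgMn; last exact/cz/groupM.
by rewrite abn mulg1 -expg_mod_order oz modn2 odd_n.
Qed.

(** If [z] is in [<a, b>], this group is [H] and [a * b] has order [m]. Otherwise [H] is its direct
    product with [<[z]>], and [a * b] has order [m %/ 2]. *)
Lemma involutions_up_to_centre z a b : 4 <= m -> ~~ odd m -> z \in 'Z(H) -> #[z] = 2 ->
    (forall K : {group gT}, K \subset H -> 4 %| #|K| -> z \in K) ->
    {in H, forall g, #[g] = m -> g ^+ (m %/ 2) = z} ->
    a \in H -> b \in H -> #[a] = 2 -> #[b] = 2 ->
    (forall K : {group gT}, a \in K -> b \in K -> z \in K -> H \subset K) ->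
  (H :=: <<[set a; b]>> /\ (a * b) ^+ (m %/ 2) = z) \/
  (odd (m %/ 2) /\ (a * b) ^+ (m %/ 2) = 1).
Proof.
move=> m_ge4 even_m Zz oz zK zpow Ha Hb oa ob Hgen.
have /centerP[Hz cz] := Zz.
pose K := <<[set a; b]>>%G.
have sKH : K \subset H by apply: gen_set2P.
have [Ka Kb] : a \in K /\ b \in K by rewrite !mem_gen ?set21 ?set22.
have oK : #|K| = (2 * #[a * b])%N by apply: card_gen_involutions.
have [zin|znin] := boolP (z \in K).
  left; have defH : H :=: K by apply/eqP; rewrite eqEsubset sKH Hgen.
  split=> //; apply: zpow; first exact: groupM.
  by apply/eqP; rewrite -(eqn_pmul2l (isT : 0 < 2)) -oK -defH (card_isog_dihedral m_gt1).
have nK : <[z]> \subset 'N(K).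
  rewrite (subset_trans _ (cent_sub _)) // cycle_subG.
  by apply/centP => u Ku; apply: cz; apply: (subsetP sKH).
have defH : H :=: K <*> <[z]>.
  apply/eqP; rewrite eqEsubset join_subG sKH cycle_subG Hz !andbT.
  by apply: Hgen => /=; rewrite ?mem_gen // inE ?Ka ?Kb ?cycle_id ?orbT.
have om : #[a * b] = m %/ 2.
  have := card_isog_dihedral m_gt1 dihH; rewrite defH norm_joinEr //.
  rewrite TI_cardMg -?orderE.
    rewrite oz oK -mulnA => /eqP.
    by rewrite eqn_pmul2l // => /eqP <-; rewrite mulnK.
  by rewrite setIC prime_TIg -?orderE ?oz // cycle_subG.
right; split; last by rewrite -om expg_order.
(* If [m %/ 2] were even, 4 would divide [#|K| = m] and force [z] into [K]. *)
apply: contraR znin; rewrite -dvdn2 => m4; apply: zK => //.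
by rewrite oK om (@dvdn_pmul2l 2 2).
Qed.

(** Since [r2 = z * r0] and [rho2 = z * rho0], the dichotomy applies to [r0], [rho0]: row 1 if they
    generate [z], row 2 otherwise. *)
Lemma rows12_of_centre z r0 r2 rho0 rho2 :
    4 <= m -> ~~ odd m -> z \in 'Z(H) -> #[z] = 2 ->
    (forall K : {group gT}, K \subset H -> 4 %| #|K| -> z \in K) ->
    {in H, forall g, #[g] = m -> g ^+ (m %/ 2) = z} ->
    #[r0] = 2 -> #[r2] = 2 -> #[rho0] = 2 -> #[rho2] = 2 ->
    H :=: <<[set r0; r2; rho0; rho2]>> ->
    r0 * r2 = z -> rho0 * rho2 = z ->
  exists2 i, row_cond i m & row_rel i m H r0 r2 rho0 rho2.
Proof.
move=> m4 even_m Zz oz zK zpow o0 o2 or0 or2 defH r02 rho02.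
have /centerP[Hz cz] := Zz.
have [[H0 H2] [Hr0 Hr2]] : (r0 \in H /\ r2 \in H) /\ (rho0 \in H /\ rho2 \in H).
  by rewrite defH !mem_gen ?inE ?eqxx ?orbT.
have E2 : r2 = z * r0 by rewrite cz // -r02 mulgA order2K // mul1g.
have Er2 : rho2 = z * rho0 by rewrite cz // -rho02 mulgA order2K // mul1g.
have E0 : r0 = z * r2 by rewrite E2 mulgA order2K // mul1g.
have Er0 : rho0 = z * rho2 by rewrite Er2 mulgA order2K // mul1g.
have Hgen (K : {group gT}) : r0 \in K -> rho0 \in K -> z \in K -> H \subset K.
  by move=> K0 Kr0 Kz; rewrite defH gen_set4P // ?E2 ?Er2 groupM.
(* Twisting [r0] or [rho0] by [z] loses nothing as long as [z] is a power of the product of the new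
   pair. *)
have gen2 a b : a \in H -> b \in H -> (r0 \in [set a; z * a]) ->
   (rho0 \in [set b; z * b]) -> (a * b) ^+ (m %/ 2) = z -> H :=: <<[set a; b]>>.
  move=> Ha Hb a0 b0 abz; apply/eqP; rewrite eqEsubset gen_set2P // andbT.
  have Ka : a \in <<[set a; b]>> by rewrite mem_gen ?set21.
  have Kb : b \in <<[set a; b]>> by rewrite mem_gen ?set22.
  have Kz : z \in <<[set a; b]>> by rewrite -abz groupX // groupM.
  apply: Hgen => //.
    by case/set2P: a0 => ->; rewrite ?groupM.
  by case/set2P: b0 => ->; rewrite ?groupM.
have [[defH' pz] | [odd_n p1]] :=
    involutions_up_to_centre m4 even_m Zz oz zK zpow H0 Hr0 o0 or0 Hgen.
  exists Row1; first by rewrite /row_cond even_m m4.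
  have E : r2 * rho2 = r0 * rho0.
    by rewrite E2 Er2 -mulgA (mulgA r0) -(cz r0) // !mulgA order2K // mul1g.
  split; rewrite ?E ?pz ?r02 ?rho02 //.
  by apply: gen2; rewrite ?E ?pz ?inE -?E0 -?Er0 ?eqxx ?orbT.
exists Row2; first by rewrite /row_cond even_m m4.
have p20 : (r2 * rho0) ^+ (m %/ 2) = z by rewrite E2 central_twist.
have p02 : (r0 * rho2) ^+ (m %/ 2) = z.
  by rewrite Er2 mulgA -(cz r0) // central_twist.
by split; rewrite ?p20 ?p02 ?r02 ?rho02 //; apply: gen2;
   rewrite ?p20 ?p02 ?inE -?E0 -?Er0 ?eqxx ?orbT.
Qed.

(** [rho0] is the central involution, and the dichotomy applies to [r2], [rho2]. In its second case
    the twist [r0 = rho0 * r2] makes [rho0] a power of [r0 * rho2]. *)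
Lemma rows34_of_centre r0 r2 rho0 rho2 : 4 <= m -> ~~ odd m -> rho0 \in 'Z(H) ->
    (forall K : {group gT}, K \subset H -> 4 %| #|K| -> rho0 \in K) ->
    {in H, forall g, #[g] = m -> g ^+ (m %/ 2) = rho0} ->
    #[r0] = 2 -> #[r2] = 2 -> #[rho0] = 2 -> #[rho2] = 2 ->
    H :=: <<[set r0; r2; rho0; rho2]>> ->
    r0 * r2 = rho0 ->
  exists2 i, row_cond i m & row_rel i m H r0 r2 rho0 rho2.
Proof.
move=> m4 even_m Zz zK zpow o0 o2 oz or2 defH r02.
have /centerP[Hz cz] := Zz.
have [[H0 H2] Hr2] : (r0 \in H /\ r2 \in H) /\ rho2 \in H.
  by rewrite defH !mem_gen ?inE ?eqxx ?orbT.
have E2 : r2 = rho0 * r0 by rewrite cz // -r02 mulgA order2K // mul1g.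
have E0 : r0 = rho0 * r2 by rewrite E2 mulgA order2K // mul1g.
have Hgen (K : {group gT}) : r2 \in K -> rho2 \in K -> rho0 \in K -> H \subset K.
  by move=> K2 Kr2 Kz; rewrite defH gen_set4P // E0 groupM.
have [[defH' pz] | [odd_n p1]] :=
    involutions_up_to_centre m4 even_m Zz oz zK zpow H2 Hr2 o2 or2 Hgen.
  by exists Row3; rewrite /row_cond ?even_m ?m4.
exists Row4; first by rewrite /row_cond even_m m4.
have p02 : (r0 * rho2) ^+ (m %/ 2) = rho0 by rewrite E0 central_twist.
split=> //; apply/eqP; rewrite eqEsubset gen_set2P // andbT.
have K0 : r0 \in <<[set r0; rho2]>> by rewrite mem_gen ?set21.
have Kr2 : rho2 \in <<[set r0; rho2]>> by rewrite mem_gen ?set22.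
have Kz : rho0 \in <<[set r0; rho2]>> by rewrite -p02 groupX // groupM.
by apply: Hgen; rewrite // E2 groupM.
Qed.

(** [V] and [F] stand for the numbers of vertices and faces; with [m] edges, [V + F < m] says that
    the Euler characteristic is negative. *)
Lemma row_classification r0 r2 rho0 rho2 V F :
    #[r0] = 2 -> #[r2] = 2 -> #[rho0] = 2 -> #[rho2] = 2 ->
    commute r0 r2 -> commute rho0 rho2 -> r0 != r2 -> rho0 != rho2 ->
    H :=: <<[set r0; r2; rho0; rho2]>> ->
    (V * #|<<[set r2; rho2]>>| = 2 * m)%N ->
    (F * #|<<[set r0; rho0]>>| = 2 * m)%N -> V + F < m ->
  [/\ ~~ odd m, 4 <= m & exists2 i, row_cond i m &
     [\/ row_rel i m H r0 r2 rho0 rho2, row_rel i m H r2 r0 rho2 rho0,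
         row_rel i m H rho0 rho2 r0 r2 | row_rel i m H rho2 rho0 r2 r0]].
Proof.
move=> o0 o2 or0 or2 cr crho r02 rho02 defH cV cF VF.
have [[H0 H2] [Hr0 Hr2]] : (r0 \in H /\ r2 \in H) /\ (rho0 \in H /\ rho2 \in H).
  by rewrite defH !mem_gen ?inE ?eqxx ?orbT.
have even_m : ~~ odd m by apply: (dihedral_even _ dihH H0 H2).
have m4 : 4 <= m.
  have V0 : 0 < V by move: cV; case: (V) => //; rewrite mul0n; move: m_gt1; clear; lia.
  have F0 : 0 < F by move: cF; case: (F) => //; rewrite mul0n; move: m_gt1; clear; lia.
  by move: V0 F0 VF even_m m_gt1; clear; lia.
have [z [Zz oz zmem zK]] := dihedral_central_involution m_gt1 dihH even_m.
move/(_ m4) => zpow; have /centerP[Hz cz] := Zz.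
have le4 a b : #[a] = 2 -> #[b] = 2 -> a = z \/ b = z -> a \in H -> b \in H ->
   #|<<[set a; b]>>| <= 4.
  move=> oa ob abz Ha Hb; rewrite card_gen_involutions // (@leq_pmul2l 2 _ 2) //.
  apply: dvdn_leq => //; rewrite order_dvdn expgMn; last first.
    by case: abz => ->; [apply: cz | apply/commute_sym/cz].
  by rewrite [a ^+ 2](order2K oa) [b ^+ 2](order2K ob) mulg1.
split=> //.
have eq2 : #|<<[set z; z]>>| = 2 by rewrite setUid -orderE.
have [e0|e2|er] := zmem _ _ H0 H2 o0 o2 r02 cr;
have [f0|f2|fr] := zmem _ _ Hr0 Hr2 or0 or2 rho02 crho.
(* [z] in matching positions: the face group (later, the vertex group) has order 2, so [F] (or [V])
   is [m]. *)
- by move: cF VF; rewrite e0 f0 eq2; clear; lia.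
(* [z] in opposite positions: vertex and face groups both have order at most 4, so [V] and [F] are
   at least [m / 2]. *)
- have h2 := leq_mul (leqnn V) (le4 _ _ o2 or2 (or_intror f2) H2 Hr2).
  have h0 := leq_mul (leqnn F) (le4 _ _ o0 or0 (or_introl e0) H0 Hr0).
  by move: h0 h2 VF; rewrite cF cV; clear; lia.
(* [z] in one pair only: a twin or dual arrangement moves it to the place of [rho0]. *)
- have defH' : H :=: <<[set rho0; rho2; r0; r2]>>.
    by rewrite defH; congr <<_>>; apply/setP=> u; rewrite !inE; do 4!case: eqP.
  rewrite -e0 in Zz zpow zmem zK; rewrite -e0 in fr.
  have [i ic ir] := rows34_of_centre m4 even_m Zz zK zpow or0 or2 o0 o2 defH' fr.
  by exists i; [exact: ic | exact: Or43 ir].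
- have h2 := leq_mul (leqnn V) (le4 _ _ o2 or2 (or_introl e2) H2 Hr2).
  have h0 := leq_mul (leqnn F) (le4 _ _ o0 or0 (or_intror f0) H0 Hr0).
  by move: h0 h2 VF; rewrite cF cV; clear; lia.
- by move: cV VF; rewrite e2 f2 eq2; clear; lia.
- have defH' : H :=: <<[set rho2; rho0; r2; r0]>>.
    by rewrite defH; congr <<_>>; apply/setP=> u; rewrite !inE; do 4!case: eqP.
  rewrite -e2 in Zz zpow zmem zK; rewrite -e2 crho in fr.
  have [i ic ir] := rows34_of_centre m4 even_m Zz zK zpow or2 or0 o2 o0 defH' fr.
  by exists i; [exact: ic | exact: Or44 ir].
- rewrite -f0 in Zz zpow zmem zK; rewrite -f0 in er.
  have [i ic ir] := rows34_of_centre m4 even_m Zz zK zpow o0 o2 or0 or2 defH er.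
  by exists i; [exact: ic | exact: Or41 ir].
- have defH' : H :=: <<[set r2; r0; rho2; rho0]>>.
    by rewrite defH; congr <<_>>; apply/setP=> u; rewrite !inE; do 4!case: eqP.
  rewrite -f2 in Zz zpow zmem zK; rewrite -f2 cr in er.
  have [i ic ir] := rows34_of_centre m4 even_m Zz zK zpow o2 o0 or2 or0 defH' er.
  by exists i; [exact: ic | exact: Or42 ir].
- have [i ic ir] := rows12_of_centre m4 even_m Zz oz zK zpow o0 o2 or0 or2 defH er fr.
  by exists i; [exact: ic | exact: Or41 ir].
Qed.

End Classification.

(** * Morphisms defined on a pair of generating involutions *)

Section InvolutionMorphism.

Variables (gT rT : finGroupType).

(* The subgroup generated by (a, a') and (b, b') is the graph of the morphism. *)
Lemma involutions_morphism (H : {group gT}) (a b : gT) (a' b' : rT) :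
    H :=: <<[set a; b]>> -> #[a] = 2 -> #[b] = 2 -> #[a'] = 2 -> #[b'] = 2 ->
    #[a * b] = #[a' * b'] ->
  exists phi : {morphism H >-> rT}, phi a = a' /\ phi b = b'.
Proof.
move=> defH oa ob oa' ob' oab.
pose p : gT * rT := (a, a'); pose q : gT * rT := (b, b').
have powE (u : gT) (v : rT) n : ((u, v) : gT * rT) ^+ n = (u ^+ n, v ^+ n).
  by elim: n => // n IH; rewrite !expgS IH.
have order_pair (u : gT) (v : rT) : #[u] = #[v] -> #[(u, v) : gT * rT] = #[u].
  move=> uv; apply/eqP; rewrite eqn_dvd !order_dvdn powE {2}uv !expg_order eqxx /=.
  by have := expg_order ((u, v) : gT * rT); rewrite powE => /(congr1 fst) /= ->.
have op : #[p] = 2 by rewrite order_pair ?oa'.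
have oq : #[q] = 2 by rewrite order_pair ?ob'.
have oG : #|<<[set p; q]>>| = #|<<[set a; b]>>|.
  by rewrite !card_gen_involutions // [#[p * q]]order_pair.
pose f := [morphism of restrm (subsetT <<[set p; q]>>%G) fst].
have imf : f @* <<[set p; q]>> = <<[set a; b]>>.
  rewrite morphim_restrm setIid morphim_gen ?subsetT // morphimU.
  by rewrite !morphim_set1 ?inE.
(* The equality of the orders of [a * b] and [a' * b'] makes the graph as large as [H], so the first
   projection is invertible on it. *)
have injf : 'injm f by rewrite -card_im_injm imf oG.
have Gp : p \in <<[set p; q]>> by rewrite mem_gen ?set21.
have Gq : q \in <<[set p; q]>> by rewrite mem_gen ?set22.
have gM : {in H &, {morph snd \o invm injf : x y / x * y}}.
  by move=> x y; rewrite defH -imf => fx fy; rewrite /= morphM.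
have fp : f p = a by []; have fq : f q = b by [].
exists (Morphism gM); rewrite /=.
by rewrite -{1}fp -fq !invmE.
Qed.

End InvolutionMorphism.

(** * Orders, morphisms and models for the four rows *)

Section Rows.

Definition row_valency (i : list_entry) (m : nat) : nat :=
  match i with Row1 | Row3 => 2 * m | Row2 | Row4 => m end.

Definition row_face_length (i : list_entry) (m : nat) : nat :=
  match i with Row1 => 2 * m | Row2 => m | Row3 | Row4 => 4 end.

(** [a] and [b] invert [a * b], hence also its half power, which is its own inverse. *)
Lemma involution_pow_central (gT : finGroupType) (a b : gT) m :
    #[a] = 2 -> #[b] = 2 -> #[a * b] = m -> ~~ odd m ->
  (a * b) ^+ (m %/ 2) \in 'Z(<<[set a; b]>>).
Proof.
move=> oa ob om even_m; set z := _ ^+ _.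
have zz : z^-1 = z.
  by apply/eqP; rewrite eq_invg_mul -expgD addnn -mul2n mulnC
    divnK ?dvdn2 // -om expg_order.
have aV := order2V oa; have bV := order2V ob.
have za : z ^ a = z.
  rewrite -{2}zz /z conjXg -expgVn conjgE invMg aV bV !mulgA.
  by rewrite (order2K oa) mul1g.
have zb : z ^ b = z.
  rewrite -{2}zz /z conjXg -expgVn conjgE invMg aV bV -!mulgA.
  by rewrite (order2K ob) mulg1.
rewrite inE groupX ?groupM ?mem_gen ?set21 ?set22 //= cent_gen.
by apply/centP => u /set2P[] ->; apply/commgP; rewrite -conjg_fix ?za ?zb.
Qed.

Lemma order_mul_commute (gT : finGroupType) (a b : gT) :
  #[a] = 2 -> #[b] = 2 -> commute a b -> #[a * b] <= 2.
Proof.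
move=> oa ob cab; apply: dvdn_leq; rewrite // order_dvdn expgMn //.
by rewrite [a ^+ 2](order2K oa) [b ^+ 2](order2K ob) mulg1.
Qed.

(** [n.+1] is even and coprime to [n], so its gcd with [2 * n] is 2. Thus multiplying [c] by its
    half-turn [c ^+ n] halves its order. *)
Lemma order_half_succ (gT : finGroupType) (c : gT) n :
  #[c] = (2 * n)%N -> odd n -> #[c ^+ n.+1] = n.
Proof.
move=> oc odd_n; have n_gt0 := odd_gt0 odd_n.
rewrite orderXgcd oc.
have defn : n.+1 = (2 * n.+1./2)%N by rewrite mul2n halfK /= odd_n subn0.
have : coprime n (2 * n.+1./2) by rewrite -defn coprimenS.
rewrite coprimeMr => /andP[_ /eqP co_n].
by rewrite defn -muln_gcdr co_n mulKn.
Qed.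

Variables (gT : finGroupType) (H : {group gT}) (m : nat).
Variables (r0 r2 rho0 rho2 : gT) (i : list_entry).
Hypotheses (oH : #|H| = (2 * m)%N) (cond : row_cond i m)
  (rel : row_rel i m H r0 r2 rho0 rho2).
Hypotheses (o0 : #[r0] = 2) (o2 : #[r2] = 2) (or0 : #[rho0] = 2) (or2 : #[rho2] = 2).
Hypotheses (cr : commute r0 r2) (crho : commute rho0 rho2).

Let order_gen a b : #[a] = 2 -> #[b] = 2 -> H :=: <<[set a; b]>> -> #[a * b] = m.
Proof.
move=> oa ob defH; apply/eqP; rewrite -(@eqn_pmul2l 2) //.
by rewrite -card_gen_involutions // -defH oH.
Qed.

Let m_div2 : m = (2 * (m %/ 2))%N.
Proof. by rewrite mulnC divnK // dvdn2; case/and3P: cond. Qed.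

(** Properness, valency and face length in group terms: the vertex group [<r2, rho2>] has order the
    valency, and [<r0, rho0>] the face length. *)
Lemma row_orders :
  [/\ r0 != r2, rho0 != rho2,
      #|<<[set r2; rho2]>>| = row_valency i m
    & #|<<[set r0; rho0]>>| = row_face_length i m].
Proof.
have /and3P[even_m m4 ci] := cond.
have neq_of a b : #[a] = 2 -> #[b] = 2 -> a * b != 1 -> a != b.
  by move=> oa _; apply: contraNneq => <-; rewrite order2K.
have half_neq1 c : #[c] = m -> c ^+ (m %/ 2) != 1.
  move=> oc; rewrite -order_dvdn oc; apply/negP => /dvdn_leq.
  by move: m4 m_div2; clear; lia.
have c0 : commute r0 (r0 * r2) by apply: commuteM.
have c2 : commute r2 (r0 * r2) by apply: commuteM => //; apply: commute_sym.
have r0r2 : r0 * (r0 * r2) = r2 by rewrite mulgA order2K // mul1g.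
have rho_K : rho0 * (rho0 * rho2) = rho2 by rewrite mulgA order2K // mul1g.
case: (i) rel ci => /=.
- case=> H0 H2 e z1 z2 _.
  have om := order_gen o0 or0 H0.
  by split; rewrite -?H0 -?H2 //; apply: neq_of; rewrite // ?e z1 half_neq1.
- case=> H0 H2 e z1 z2 odd_n.
  have om := order_gen o2 or0 H0.
  have om' := order_gen o0 or2 H2.
  split; first by apply: neq_of; rewrite // ?e z1 half_neq1.
  + by apply: neq_of; rewrite // ?e z1 half_neq1.
  + rewrite card_gen_involutions //.
    (* [r2 * rho2] is [r2 * rho0] times its own half-turn, so its order is [m %/ 2]. *)
    have -> : r2 * rho2 = (r2 * rho0) * (rho0 * rho2) by rewrite -mulgA rho_K.
    by rewrite z1 -expgS order_half_succ // om.
  + rewrite card_gen_involutions //.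
    have -> : r0 * rho0 = (r0 * rho2) * (rho0 * rho2).
      by rewrite crho -mulgA (mulgA rho2) order2K // mul1g.
    by rewrite z1 z2 -expgS order_half_succ // om'.
- case=> H2 e z _; have om := order_gen o2 or2 H2.
  have kf : #|<<[set r0; rho0]>>| = 4.
    by rewrite card_gen_involutions // -e r0r2 o2.
  split; rewrite -?H2 //.
    by apply: neq_of; rewrite // e z half_neq1.
  (* If [rho2 = rho0 = r0 * r2], then [rho2] commutes with [r2], and [r2 * rho2] cannot have order
     [m >= 4]. *)
  apply/eqP => e2; have := order_mul_commute o2 or2.
  by rewrite om -e2 -e leqNgt (leq_trans _ m4) // => /(_ c2).
- case=> H2 e z odd_n; have om := order_gen o0 or2 H2.
  have kf : #|<<[set r0; rho0]>>| = 4.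
    by rewrite card_gen_involutions // -e r0r2 o2.
  split=> //.
  + by apply: neq_of; rewrite // e z half_neq1.
  + apply/eqP => e2; have := order_mul_commute o0 or2.
    by rewrite om -e2 -e leqNgt (leq_trans _ m4) // => /(_ c0).
  + rewrite card_gen_involutions //.
    have -> : r2 * rho2 = rho0 * (r0 * rho2).
      by rewrite mulgA -e cr -(mulgA r2) order2K // mulg1.
    by rewrite z -expgSr order_half_succ // om.
Qed.

(** Obstruction to full regularity: a colour-reversing automorphism would carry [r0] to [rho0]. If
    [r0] were central, a generating pair would commute and its product could not have order
    [m >= 4]. *)
Lemma row34_centre : i = Row3 \/ i = Row4 -> rho0 \in 'Z(H) /\ r0 \notin 'Z(H).
Proof.
have /and3P[even_m m4 _] := cond.
case=> ei; move: rel; rewrite ei /=.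
  case=> defH e z; have om := order_gen o2 or2 defH.
  have Zz : rho0 \in 'Z(H) by rewrite z defH involution_pow_central.
  split=> //; apply/negP => Z0; have Z2 : r2 \in 'Z(H).
    by rewrite -(groupMl _ Z0) e.
  have := order_mul_commute o2 or2; rewrite om leqNgt (leq_trans _ m4) //.
  have /centerP[_ /(_ rho2) c22] := Z2.
  have cc : commute r2 rho2 by apply: c22; rewrite defH mem_gen ?set22.
  by move=> /(_ cc).
case=> defH e z; have om := order_gen o0 or2 defH.
have Zz : rho0 \in 'Z(H) by rewrite z defH involution_pow_central.
split=> //; apply/negP => Z0.
have := order_mul_commute o0 or2; rewrite om leqNgt (leq_trans _ m4) //.
have /centerP[_ /(_ rho2) c02] := Z0.
have cc : commute r0 rho2 by apply: c02; rewrite defH mem_gen ?set22.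
by move=> /(_ cc).
Qed.

End Rows.

(** In each row two involutions with product of order [m] generate, and the other generators are
    words in them, so matching these two suffices. *)
Lemma row_morphism (gT rT : finGroupType) (H : {group gT}) (K : {group rT})
    (m : nat) (i : list_entry) (r0 r2 rho0 rho2 : gT) (s0 s2 sigma0 sigma2 : rT) :
    #|H| = (2 * m)%N -> #|K| = (2 * m)%N ->
    row_rel i m H r0 r2 rho0 rho2 -> row_rel i m K s0 s2 sigma0 sigma2 ->
    #[r0] = 2 -> #[r2] = 2 -> #[rho0] = 2 -> #[rho2] = 2 ->
    #[s0] = 2 -> #[s2] = 2 -> #[sigma0] = 2 -> #[sigma2] = 2 ->
  exists phi : {morphism H >-> rT},
    [/\ phi r0 = s0, phi r2 = s2, phi rho0 = sigma0 & phi rho2 = sigma2].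
Proof.
move=> oH oK relH relK o0 o2 or0 or2 os0 os2 osi0 osi2.
have ord (gT' : finGroupType) (L : {group gT'}) (a b : gT') : #[a] = 2 -> #[b] = 2 ->
    #|L| = (2 * m)%N -> L :=: <<[set a; b]>> -> #[a * b] = m.
  move=> oa ob oL defL; apply/eqP; rewrite -(@eqn_pmul2l 2) //.
  by rewrite -card_gen_involutions // -defL oL.
have hom a b a' b' : #[a] = 2 -> #[b] = 2 -> #[a'] = 2 -> #[b'] = 2 ->
    H :=: <<[set a; b]>> -> K :=: <<[set a'; b']>> ->
    exists phi : {morphism H >-> rT}, [/\ a \in H, b \in H, phi a = a', phi b = b'
      & phi ((a * b) ^+ (m %/ 2)) = (a' * b') ^+ (m %/ 2)].
  move=> oa ob oa' ob' defH defK.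
  have [|phi [pa pb]] := involutions_morphism defH oa ob oa' ob'.
    by rewrite (ord _ H) // (ord _ K).
  exists phi; have Ha : a \in H by rewrite defH mem_gen ?set21.
  have Hb : b \in H by rewrite defH mem_gen ?set22.
  by split; rewrite // morphX ?groupM // morphM // pa pb.
have KL (gT' : finGroupType) (a b : gT') : #[a] = 2 -> b = a * (a * b).
  by move=> oa; rewrite mulgA order2K // mul1g.
have KR (gT' : finGroupType) (a b : gT') : #[b] = 2 -> a = a * b * b.
  by move=> oa; rewrite -mulgA order2K // mulg1.
case: i relH relK => /=.
- case=> HH0 _ e z _ [KK0 _ e' z' _].
  have [phi [Ha Hb pa pb pz]] := hom _ _ _ _ o0 or0 os0 osi0 HH0 KK0.
  exists phi; split=> //.
    by rewrite (KL _ r0 r2) // e z (KL _ s0 s2) // e' z' morphM ?groupX ?groupM // pa pz.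
  by rewrite (KL _ rho0 rho2) // z (KL _ sigma0 sigma2) // z'
    morphM ?groupX ?groupM // pb pz.
- case=> HH0 _ e z _ [KK0 _ e' z' _].
  have [phi [Ha Hb pa pb pz]] := hom _ _ _ _ o2 or0 os2 osi0 HH0 KK0.
  exists phi; split=> //.
    by rewrite (KR _ r0 r2) // e z (KR _ s0 s2) // e' z' morphM ?groupX ?groupM // pa pz.
  by rewrite (KL _ rho0 rho2) // z (KL _ sigma0 sigma2) // z'
    morphM ?groupX ?groupM // pb pz.
- case=> HH0 e z [KK0 e' z'].
  have [phi [Ha Hb pa pb pz]] := hom _ _ _ _ o2 or2 os2 osi2 HH0 KK0.
  exists phi; split; rewrite // ?z ?z' //.
  by rewrite (KR _ r0 r2) // e z (KR _ s0 s2) // e' z' morphM ?groupX ?groupM // pa pz.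
- case=> HH0 e z [KK0 e' z'].
  have [phi [Ha Hb pa pb pz]] := hom _ _ _ _ o0 or2 os0 osi2 HH0 KK0.
  exists phi; split; rewrite // ?z ?z' //.
  by rewrite (KL _ r0 r2) // e z (KL _ s0 s2) // e' z' morphM ?groupX ?groupM // pa pz.
Qed.

(** With involutions [a], [b] generating the group and half-turn [z], the quadruples are
    [(a, az, b, bz)], [(az, a, b, bz)], [(az, a, z, b)] and [(a, az, z, b)]. *)
Lemma row_group_exists (m : nat) (i : list_entry) : row_cond i m ->
  exists r0 r2 rho0 rho2 : 'D_(2 * m),
    [/\ [/\ #[r0] = 2, #[r2] = 2, #[rho0] = 2 & #[rho2] = 2],
        commute r0 r2, commute rho0 rho2,
        <<[set r0; r2; rho0; rho2]>> = [set: 'D_(2 * m)]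
      & row_rel i m [set: 'D_(2 * m)] r0 r2 rho0 rho2].
Proof.
move=> cond; have /and3P[even_m m4 _] := cond.
have m_gt1 : 1 < m by apply: leq_trans m4.
have oD : #|'D_(2 * m)| = (2 * m)%N by rewrite mul2n card_dihedral.
have [[a b] /= /eqP[defD a2 b2 abm]] : exists xy : 'D_(2 * m) * 'D_(2 * m),
    (<[xy.1]> <*> <[xy.2]>, (xy.1 ^+ 2, (xy.2 ^+ 2, (xy.1 * xy.2) ^+ m)))
      == ([set: 'D_(2 * m)], (1, (1, 1))).
  have := Grp'_dihedral m_gt1; rewrite -mul2n => /isoGrp_hom.
  by case/existsP=> -[x y] /= xy; exists (x, y).
(* If [a] or [b] were trivial, the other would generate a group of order at most 2. *)
have card_le (c : 'D_(2 * m)) : c ^+ 2 = 1 -> [set: 'D_(2 * m)] != <[c]>.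
  move=> c2; apply/eqP => defc; have : #|<[c]>| <= 2.
    by apply: dvdn_leq; rewrite // -orderE order_dvdn c2.
  by rewrite -defc oD; move: m4; clear; lia.
have oa : #[a] = 2.
  apply/eqP/order2P; split=> //; apply: contraNneq (card_le b b2) => a1.
  by rewrite -defD a1 cycle1 joing1G.
have ob : #[b] = 2.
  apply/eqP/order2P; split=> //; apply: contraNneq (card_le a a2) => b1.
  by rewrite -defD b1 cycle1 joingG1.
have defT : [set: 'D_(2 * m)] = <<[set a; b]>>.
  by rewrite -defD joing_idl joing_idr.
have om : #[a * b] = m.
  by apply/eqP; rewrite -(@eqn_pmul2l 2) // -card_gen_involutions // -defT oD.
pose z := (a * b) ^+ (m %/ 2).
have Zz : z \in 'Z([set: 'D_(2 * m)]) by rewrite {1}defT involution_pow_central.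
have cz u : commute z u by have /centerP[_ c] := Zz; apply: c; rewrite inE.
have oz : #[z] = 2.
  have m2 : 2 %| m by rewrite dvdn2.
  by rewrite orderXdiv om ?dvdn_div // divnA // mulKn // ltnW.
(* [u = z] would commute with [v], so [u * v] would have order at most 2; hence [u * z] is not
   trivial. *)
have not_central u v : #[u] = 2 -> #[v] = 2 -> #[u * v] = m -> u != z.
  move=> ou ov ouv; apply/eqP=> uz; have := order_mul_commute ou ov.
  by rewrite ouv leqNgt (leq_trans _ m4) // uz => /(_ (cz v)).
have oba : #[b * a] = m by rewrite -[#[_]]orderV invMg !order2V.
have twist2 u v : #[u] = 2 -> #[v] = 2 -> #[u * v] = m -> #[u * z] = 2.
  move=> ou ov ouv; apply/eqP/order2P; split.
    rewrite -eq_invg_mul order2V //; exact: not_central ouv.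
  by rewrite -mulgA (mulgA z) cz -!mulgA order2K // mulg1 order2K.
have oaz := twist2 a b oa ob om; have obz := twist2 b a ob oa oba.
(* The twisted pair has the same product, so it generates [z] and then [a] and [b]. *)
have azbz : a * z * (b * z) = a * b.
  by rewrite -mulgA (mulgA z) cz -!mulgA order2K // mulg1.
have aaz : a * (a * z) = z by rewrite mulgA order2K // mul1g.
have bbz : b * (b * z) = z by rewrite mulgA order2K // mul1g.
have aza : a * z * a = z by rewrite -mulgA cz mulgA order2K // mul1g.
have bzb : b * z * b = z by rewrite -mulgA cz mulgA order2K // mul1g.
have caz : commute a (a * z) by rewrite /commute aaz aza.
have cbz : commute b (b * z) by rewrite /commute bbz bzb.
have defT' : [set: 'D_(2 * m)] = <<[set a * z; b * z]>>.
  apply/eqP; rewrite eqEsubset subsetT andbT {1}defT.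
  have Ka : a * z \in <<[set a * z; b * z]>> by rewrite mem_gen ?set21.
  have Kb : b * z \in <<[set a * z; b * z]>> by rewrite mem_gen ?set22.
  have Kz : z \in <<[set a * z; b * z]>>.
    by have := groupX (m %/ 2) (groupM Ka Kb); rewrite azbz.
  by apply: gen_set2P; rewrite -(groupMr _ Kz).
have gen4 r0 r2 rho0 rho2 :
    a \in [set r0; r2; rho0; rho2] -> b \in [set r0; r2; rho0; rho2] ->
    <<[set r0; r2; rho0; rho2]>> = [set: 'D_(2 * m)].
  move=> Sa Sb; apply/eqP; rewrite eqEsubset subsetT defT /=.
  by apply: gen_set2P; apply: mem_gen.
have caz' := commute_sym caz; have czb := cz b.
case: i cond => _.
- exists a, (a * z), b, (b * z); split=> //; last by split; rewrite ?azbz ?aaz ?bbz.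
  by apply: gen4; rewrite !inE eqxx ?orbT.
- exists (a * z), a, b, (b * z); split=> //.
    by apply: gen4; rewrite !inE eqxx ?orbT.
  by split; rewrite ?azbz ?aza ?bbz.
- exists (a * z), a, z, b; split=> //.
  by apply: gen4; rewrite !inE eqxx ?orbT.
exists a, (a * z), z, b; split=> //.
by apply: gen4; rewrite !inE eqxx ?orbT.
Qed.

(** * Maps with a marked corner *)

Section Automorphisms.

Variable M : cmap.
Implicit Types (c d h : {perm flag M}) (x w : flag M).

Lemma full_autP c : reflect
  [/\ forall x, c (t0 M x) = t0 M (c x), forall x, c (t1 M x) = t1 M (c x)
    & forall x, c (t2 M x) = t2 M (c x)] (c \in full_aut M).
Proof.
have commP (s : {perm flag M}) : commute c s <-> forall x, c (s x) = s (c x).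
  split=> [cs x | cs]; first by rewrite -!permM cs.
  by apply/permP=> x; rewrite !permM cs.
apply: (iffP centP) => [cc | [c0 c1 c2] s].
  by split; apply/commP/cc; rewrite !inE eqxx ?orbT.
by rewrite !inE -orbA => /or3P[] /eqP-> ; apply/commP.
Qed.

Lemma colour_autP c : reflect
  (c \in full_aut M /\ forall x, (c x \in shaded M) = (x \in shaded M))
  (c \in colour_aut M).
Proof.
apply: (iffP setIP) => [[Fc Nc] | [Fc Nc]]; split=> //.
  by move=> x; rewrite -(astabs_act x Nc).
by apply/astabsP => x; apply: Nc.
Qed.

Lemma colour_aut_full c : c \in colour_aut M -> c \in full_aut M.
Proof. by case/colour_autP. Qed.

(** Induction along flag adjacency: by transitivity every flag is reached from [x] by a word in
    [t0], [t1], [t2]. *)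
Lemma flag_connected (P : pred (flag M)) x :
    P x -> (forall w, P w -> [/\ P (t0 M w), P (t1 M w) & P (t2 M w)]) ->
  forall w, P w.
Proof.
move=> Px cP w.
have [g Gg ->] := atransP2 (cmap_trans M) (in_setT x) (in_setT w).
have [n [c Tc ->]] := gen_prodgP Gg.
elim: n c Tc => [|n IH] c Tc; first by rewrite big_ord0 /= /aperm perm1.
rewrite big_ord_recr /= /aperm permM.
have /cP[P0 P1 P2] := IH _ (fun i => Tc (widen_ord (leqnSn n) i)).
by have := Tc ord_max; rewrite !inE -orbA => /or3P[] /eqP ->.
Qed.

(** The flags on which [c] and [d] agree are closed under [t0], [t1], [t2]. Identities between
    automorphisms are therefore checked at one flag. *)
Lemma full_aut_inj c d x : c \in full_aut M -> d \in full_aut M -> c x = d x -> c = d.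
Proof.
move=> /full_autP[c0 c1 c2] /full_autP[d0 d1 d2] cd; apply/permP => w; apply/eqP.
move: w; apply: (flag_connected (P := fun w => c w == d w) (x := x)) => [|w /eqP cdw].
  exact/eqP.
by rewrite c0 c1 c2 d0 d1 d2 cdw !eqxx.
Qed.

Lemma exists_shaded : exists x, x \in shaded M.
Proof.
have /imsetP[x _ _] := cmap_trans M.
have [sx | sx] := boolP (x \in shaded M);
  by [exists x | exists (t1 M x); rewrite shaded_t1].
Qed.

Lemma corner_t1 x : corner (t1 M x) = corner x.
Proof. by rewrite /corner t1K setUC. Qed.

Lemma colour_aut_corner h x w : h \in colour_aut M ->
  (x \in shaded M) = (w \in shaded M) -> (h @: corner x = corner w <-> h x = w).
Proof.
move=> /colour_autP[/full_autP[_ h1 _] hs] xw.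
rewrite /corner imsetU !imset_set1 h1; split=> [/setP/(_ (h x)) | -> //].
rewrite !inE eqxx => /esym/orP[/eqP // | /eqP e].
by have := hs x; rewrite e shaded_t1 xw; case: (w \in _).
Qed.

(** A corner has exactly one shaded flag, so the action on corners is that on shaded flags;
    stabilisers are trivial by [full_aut_inj]. *)
Lemma edge_biregularP : edge_biregular M <->
  {in shaded M &, forall x w, exists2 h, h \in colour_aut M & h x = w}.
Proof.
split=> [[tr _] x w sx sw | tr].
  have Cx : corner x \in corners M by apply: imset_f.
  have Cw : corner w \in corners M by apply: imset_f.
  have [h Hh] := atransP2 tr Cx Cw; rewrite /= setactE => e.
  by exists h => //; apply/colour_aut_corner; rewrite ?sx ?sw.
have shade w : exists2 x, x \in shaded M & corner w = corner x.
  have [sw | sw] := boolP (w \in shaded M); first by exists w.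
  by exists (t1 M w); rewrite ?shaded_t1 ?corner_t1.
split=> [|_ /imsetP[w _ ->]].
  have [x sx] := exists_shaded.
  apply/imsetP; exists (corner x); first exact: imset_f.
  apply/setP=> C; apply/imsetP/orbitP => [[w _ ->] | [h Hh <-]].
    have [u su ->] := shade w; have [h Hh hx] := tr x u sx su.
    by exists h; rewrite //= setactE; apply/(colour_aut_corner Hh); rewrite ?sx ?su.
  exists (h x); rewrite //= setactE; apply/(colour_aut_corner Hh) => //.
  by have /colour_autP[_ ->] := Hh.
apply/trivgP/subsetP => h /setIP[Hh /astab1P]; rewrite /= setactE.
move/(colour_aut_corner Hh erefl) => hw; rewrite inE; apply/eqP.
by apply: (full_aut_inj (x := w)); rewrite ?group1 ?colour_aut_full ?perm1.
Qed.

(** Flag version of [written_as], with the shaded flag [x] explicit; [rho0] and [rho2] are read off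
    at the unshaded flag [t1 M x]. *)
Definition marked x (r0 r2 rho0 rho2 : {perm flag M}) : Prop :=
  [/\ x \in shaded M,
      [/\ r0 \in colour_aut M, r2 \in colour_aut M,
          rho0 \in colour_aut M & rho2 \in colour_aut M],
      r0 x = t0 M x /\ r2 x = t2 M x
    & rho0 (t1 M x) = t0 M (t1 M x) /\ rho2 (t1 M x) = t2 M (t1 M x)].

Lemma written_asP r0 r2 rho0 rho2 :
  written_as M r0 r2 rho0 rho2 <-> exists x, marked x r0 r2 rho0 rho2.
Proof.
split=> [[x sx [mem e0 e2 f0 f2]] | [x [sx mem [e0 e2] [f0 f2]]]].
  exists x; split=> //; case: mem => H0 H2 Hr0 Hr2.
    by split; apply/colour_aut_corner; rewrite ?shaded_t0 ?shaded_t2.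
  by split; apply/colour_aut_corner; rewrite ?corner_t1 ?shaded_t0 ?shaded_t2.
exists x => //; case: (mem) => H0 H2 Hr0 Hr2.
split=> //; first [by apply/colour_aut_corner; rewrite ?shaded_t0 ?shaded_t2
  | by rewrite -(corner_t1 x); apply/colour_aut_corner; rewrite ?shaded_t0 ?shaded_t2].
Qed.

Lemma apply_orbit (G : {group {perm flag M}}) g x : g \in G -> g x \in orbit 'P G x.
Proof. exact: (mem_orbit 'P). Qed.

Lemma full_aut_orbit (T : {set {perm flag M}}) h x :
  h \in full_aut M -> T \subset [set t0 M; t1 M; t2 M] ->
  orbit 'P <<T>> (h x) = h @: orbit 'P <<T>> x.
Proof.
move=> Fh sT; have hC g : g \in <<T>> -> commute h g.
  move=> Tg; have /centP : h \in 'C(<<T>>) by rewrite cent_gen (subsetP (centS sT)).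
  by apply.
apply/setP=> w; apply/orbitP/imsetP => [[g Tg <-] | [_ /orbitP[g Tg <-] ->]].
  exists (g x); first exact: apply_orbit.
  by rewrite /= /aperm -!permM hC.
by exists g; rewrite //= /aperm -!permM hC.
Qed.

Lemma flag_orbit_subset (T : {set {perm flag M}}) (U : {set flag M}) x :
  x \in U -> {in T & U, forall (s : {perm flag M}) w, s w \in U} ->
  orbit 'P <<T>> x \subset U.
Proof.
move=> Ux TU; have nT : <<T>> \subset 'N(U | 'P).
  rewrite gen_subG; apply/subsetP=> s Ts; rewrite !inE.
  by apply/subsetP=> w Uw; rewrite inE; apply: TU.
by apply/subsetP=> _ /orbitP[g Tg <-]; rewrite (astabs_act _ (subsetP nT g Tg)).
Qed.

Lemma card_flag_orbits (G : {group {perm flag M}}) n :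
  (forall x, #|orbit 'P G x| = n) ->
  (#|orbit 'P G @: [set: flag M]| * n)%N = #|flag M|.
Proof.
move=> on; rewrite -cardsT; apply/esym/card_uniform_partition.
  by move=> _ /imsetP[x _ ->].
by apply: orbit_partition; apply/actsP=> g _ x; rewrite !inE.
Qed.

(** * Orbits, generators and counts relative to a marked corner *)

Section Marked.

Hypothesis ebM : edge_biregular M.
Variables (x : flag M) (r0 r2 rho0 rho2 : {perm flag M}).
Hypothesis mx : marked x r0 r2 rho0 rho2.

Lemma marked_flagP w : exists2 h, h \in colour_aut M & w = h x \/ w = h (t1 M x).
Proof.
have [sx _ _ _] := mx; have /edge_biregularP tr := ebM.
have [sw | sw] := boolP (w \in shaded M).
  by have [h Hh <-] := tr x w sx sw; exists h => //; left.
have [|h Hh hx] := tr x (t1 M w) sx; first by rewrite shaded_t1.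
exists h => //; right.
by have /colour_autP[/full_autP[_ -> _] _] := Hh; rewrite hx t1K.
Qed.

Lemma card_two_orbits (K : {group {perm flag M}}) : K \subset colour_aut M ->
  #|orbit 'P K x :|: orbit 'P K (t1 M x)| = (2 * #|K|)%N.
Proof.
move=> sKH; have [sx _ _ _] := mx.
have oK w : #|orbit 'P K w| = #|K|.
  rewrite orbitE card_in_imset // => g h Kg Kh /=; rewrite /aperm.
  by apply: full_aut_inj; apply/colour_aut_full/(subsetP sKH).
have -> : #|orbit 'P K x :|: orbit 'P K (t1 M x)|
    = (#|orbit 'P K x| + #|orbit 'P K (t1 M x)|)%N.
  apply/eqP; rewrite (leq_card_setU _ _).2 -setI_eq0; apply/eqP/setP=> w.
  rewrite !inE; apply/andP=> [[/orbitP[g Kg <-] /orbitP[h Kh /= e]]].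
  have /colour_autP[_ gs] := subsetP sKH g Kg.
  have /colour_autP[_ hs] := subsetP sKH h Kh.
  by have := gs x; rewrite -[g x]e /= /aperm hs shaded_t1 sx.
by rewrite !oK mul2n addnn.
Qed.

Lemma marked_card_flag : #|flag M| = (2 * #|colour_aut M|)%N.
Proof.
rewrite -card_two_orbits // -cardsT; congr #|pred_of_set _|; apply/esym/setP=> w.
rewrite !inE; have [h Hh [] ->] := marked_flagP w.
  by rewrite apply_orbit.
by rewrite orbC apply_orbit.
Qed.

(** Automorphisms commute with [t1] and [s], and [r], [rho] realise [s] at the two flags of the
    corner, so each side is closed under what generates the other. Taking [s] as [t2] gives
    vertices, as [t0] faces. *)
Lemma marked_orbit (s r rho : {perm flag M}) : s \in [set t0 M; t2 M] ->
    r \in colour_aut M -> rho \in colour_aut M ->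
    r x = s x -> rho (t1 M x) = s (t1 M x) ->
  orbit 'P <<[set t1 M; s]>> x
    = orbit 'P <<[set r; rho]>> x :|: orbit 'P <<[set r; rho]>> (t1 M x).
Proof.
move=> s02 Hr Hrho rx rhox.
have sK : s (s x) = x /\ s (s (t1 M x)) = t1 M x.
  by case/set2P: s02 => ->; rewrite !(t0K, t2K).
have hs h w : h \in colour_aut M -> h (s w) = s (h w).
  by case/colour_autP=> /full_autP[h0 _ h2] _; case/set2P: s02 => ->.
have h1 h w : h \in colour_aut M -> h (t1 M w) = t1 M (h w).
  by case/colour_autP=> /full_autP[].
set T := [set t1 M; s]; set K := [set r; rho].
have sKH : <<K>> \subset colour_aut M by apply: gen_set2P.
have Kr : r \in <<K>> by rewrite mem_gen ?set21.
have Krho : rho \in <<K>> by rewrite mem_gen ?set22.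
apply/eqP; rewrite eqEsubset; apply/andP; split.
  apply: flag_orbit_subset; first by rewrite inE orbit_refl.
  move=> t w /set2P[] ->; rewrite inE => /orP[] /orbitP[k Kk <-] /=;
    have Hk := subsetP sKH k Kk; rewrite /aperm inE -?(h1 k) -?(hs k) ?t1K //.
  - by rewrite orbC apply_orbit.
  - by rewrite apply_orbit.
  - by rewrite -rx -permM apply_orbit // groupM.
  - by rewrite -rhox -permM orbC apply_orbit // groupM.
set O := orbit 'P <<T>> x.
have Ox : x \in O by apply: orbit_refl.
have Os t w : t \in T -> w \in O -> t w \in O.
  move=> Tt /orbitP[g Tg <-]; rewrite /= /aperm -permM.
  by apply: apply_orbit; rewrite groupM // mem_gen.
have O1 : t1 M x \in O by rewrite Os ?set21.
have sT : T \subset [set t0 M; t1 M; t2 M].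
  by apply/subsetP=> t; rewrite !inE => /orP[/eqP->|/eqP->];
    [rewrite eqxx orbT | case/set2P: s02 => ->; rewrite eqxx ?orbT].
(* An automorphism carries orbits to orbits, so it preserves [O] once it sends one flag of [O] into
   [O]. *)
have Oh h v : h \in colour_aut M -> v \in O -> h v \in O -> {in O, forall w, h w \in O}.
  move=> Hh Ov Ohv w Ow; have -> : O = orbit 'P <<T>> (h v) by apply/esym/orbit_eqP.
  rewrite full_aut_orbit ?colour_aut_full // mem_imset; last exact: perm_inj.
  by have /orbit_eqP -> := Ov.
have OK : {in K & O, forall (t : {perm flag M}) w, t w \in O}.
  move=> t w /set2P[] -> Ow; first by apply: (Oh _ x); rewrite ?rx ?Os ?set22.
  by apply: (Oh _ (t1 M x)); rewrite ?rhox ?Os ?set21 ?set22.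
by rewrite subUset !flag_orbit_subset.
Qed.

Lemma marked_card_orbit (s r rho : {perm flag M}) w : s \in [set t0 M; t2 M] ->
    r \in colour_aut M -> rho \in colour_aut M ->
    r x = s x -> rho (t1 M x) = s (t1 M x) ->
  #|orbit 'P <<[set t1 M; s]>> w| = (2 * #|<<[set r; rho]>>|)%N.
Proof.
move=> s02 Hr Hrho rx rhox.
have sT : [set t1 M; s] \subset [set t0 M; t1 M; t2 M].
  by apply/subsetP=> t; rewrite !inE => /orP[/eqP->|/eqP->];
    [rewrite eqxx orbT | case/set2P: s02 => ->; rewrite eqxx ?orbT].
have ox : #|orbit 'P <<[set t1 M; s]>> x| = (2 * #|<<[set r; rho]>>|)%N.
  by rewrite (marked_orbit s02 Hr Hrho) // card_two_orbits ?gen_set2P.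
have e1 : orbit 'P <<[set t1 M; s]>> (t1 M x) = orbit 'P <<[set t1 M; s]>> x.
  by apply/esym/orbit_eqP; rewrite orbit_sym apply_orbit ?mem_gen ?set21.
have [h Hh hw] := marked_flagP w; have Fh := colour_aut_full Hh.
by case: hw => ->; rewrite full_aut_orbit // ?e1 card_imset //; apply: perm_inj.
Qed.

Lemma marked_order s h w : s \in [set t0 M; t2 M] -> h \in colour_aut M ->
  h w = s w -> #[h] = 2.
Proof.
move=> s02 Hh hw; apply/eqP/order2P; split.
  apply/eqP => h1; have : s w != w by case/set2P: s02 => ->; rewrite ?t0_neq ?t2_neq.
  by rewrite -hw h1 perm1 eqxx.
apply: (full_aut_inj (x := w)); rewrite ?group1 ?colour_aut_full ?groupM //.
rewrite permM perm1 hw; have /colour_autP[/full_autP[h0 _ h2] _] := Hh.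
by case/set2P: s02 hw => -> hw; rewrite ?h0 ?h2 hw ?t0K ?t2K.
Qed.

Lemma marked_commute h k w : h \in colour_aut M -> k \in colour_aut M ->
  h w = t0 M w -> k w = t2 M w -> commute h k.
Proof.
move=> Hh Hk hw kw; apply: (full_aut_inj (x := w)); rewrite ?colour_aut_full ?groupM //.
have /colour_autP[/full_autP[_ _ h2] _] := Hh.
have /colour_autP[/full_autP[k0 _ _] _] := Hk.
by rewrite !permM hw kw k0 h2 hw kw t02C.
Qed.

Lemma marked_orders : [/\ #[r0] = 2, #[r2] = 2, #[rho0] = 2 & #[rho2] = 2].
Proof.
have [_ [H0 H2 Hr0 Hr2] [e0 e2] [f0 f2]] := mx.
by split; [apply: marked_order e0 | apply: marked_order e2 | apply: marked_order f0
  | apply: marked_order f2]; rewrite ?set21 ?set22.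
Qed.

Lemma marked_commutes : commute r0 r2 /\ commute rho0 rho2.
Proof.
have [_ [H0 H2 Hr0 Hr2] [e0 e2] [f0 f2]] := mx.
by split; [apply: marked_commute e0 e2 | apply: marked_commute f0 f2].
Qed.

(** The orbits of [x] and [t1 M x] under the generated subgroup are together closed under adjacency,
    hence contain all flags; counting gives equality. *)
Lemma marked_gen : colour_aut M :=: <<[set r0; r2; rho0; rho2]>>.
Proof.
have [_ [H0 H2 Hr0 Hr2] [e0 e2] [f0 f2]] := mx.
set K := [set _; _; _; _].
have sKH : <<K>> \subset colour_aut M by apply: gen_set4P.
apply/esym/eqP; rewrite eqEcard sKH -(@leq_pmul2l 2) // -marked_card_flag.
rewrite -(card_two_orbits sKH) subset_leq_card //; apply/subsetP => w _; move: w.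
have K4 : [/\ r0 \in <<K>>, r2 \in <<K>>, rho0 \in <<K>> & rho2 \in <<K>>].
  by split; rewrite mem_gen // !inE eqxx ?orbT.
case: K4 => K0 K2 Kr0 Kr2.
have apply2 k g w : k \in <<K>> -> g \in <<K>> -> k (g w) \in orbit 'P <<K>> w.
  by move=> Kk Kg; rewrite -permM apply_orbit ?groupM.
apply: (flag_connected (P := [in orbit 'P <<K>> x :|: orbit 'P <<K>> (t1 M x)]) (x := x)).
  by rewrite inE orbit_refl.
move=> w; rewrite !inE => /orP[] /orbitP[k Kk <-] /=; rewrite /aperm;
  have /colour_autP[/full_autP[k0 k1 k2] _] := subsetP sKH k Kk;
  rewrite -k0 -k1 -k2 ?t1K -?e0 -?e2 -?f0 -?f2;
  by split; rewrite ?(apply2 _ _ _ Kk K0) ?(apply2 _ _ _ Kk K2) ?(apply2 _ _ _ Kk Kr0)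
    ?(apply2 _ _ _ Kk Kr2) ?apply_orbit ?orbT.
Qed.

Lemma marked_proper : proper_map M <-> r0 != r2 /\ rho0 != rho2.
Proof.
have [_ [H0 H2 Hr0 Hr2] [e0 e2] [f0 f2]] := mx.
have eqE h k w : h \in colour_aut M -> k \in colour_aut M -> (h == k) = (h w == k w).
  move=> Hh Hk; apply/eqP/eqP => [-> // | ]; apply: full_aut_inj; exact: colour_aut_full.
rewrite (eqE _ _ x H0 H2) (eqE _ _ (t1 M x) Hr0 Hr2) e0 e2 f0 f2.
split=> [pr | [ne nf] w]; first by split; apply: pr.
have [h /colour_autP[/full_autP[h0 _ h2] _] [] ->] := marked_flagP w;
  by rewrite -h0 -h2 (inj_eq perm_inj).
Qed.

Lemma marked_type :
  has_type M #|<<[set r2; rho2]>>| #|<<[set r0; rho0]>>|.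
Proof.
have [_ [H0 H2 Hr0 Hr2] [e0 e2] [f0 f2]] := mx.
split=> _ /imsetP[w _ ->]; first by rewrite (marked_card_orbit w _ H2 Hr2) ?set22.
by rewrite [[set t0 M; _]]setUC (marked_card_orbit w _ H0 Hr0) ?set21.
Qed.

Lemma marked_vertices :
  (#|vertices M| * #|<<[set r2; rho2]>>|)%N = #|colour_aut M|.
Proof.
have [+ _] := marked_type => ty.
apply/eqP; rewrite -(@eqn_pmul2l 2) // mulnCA -marked_card_flag; apply/eqP.
by apply: card_flag_orbits => w; apply: ty; apply: imset_f.
Qed.

Lemma marked_faces :
  (#|faces M| * #|<<[set r0; rho0]>>|)%N = #|colour_aut M|.
Proof.
have [_ +] := marked_type => ty.
apply/eqP; rewrite -(@eqn_pmul2l 2) // mulnCA -marked_card_flag; apply/eqP.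
by apply: card_flag_orbits => w; apply: ty; apply: imset_f.
Qed.

(** Without semi-edges each edge carries four distinct flags, out of [2 * #|colour_aut M|] in
    all. *)
Lemma marked_edges : proper_map M -> (2 * #|edges M|)%N = #|colour_aut M|.
Proof.
move=> pr; apply/eqP; rewrite -(@eqn_pmul2l 2) // mulnA -marked_card_flag mulnC.
apply/eqP.
apply: card_flag_orbits => w.
have -> : orbit 'P <<[set t0 M; t2 M]>> w
    = [set w; t0 M w] :|: [set t2 M w; t0 M (t2 M w)].
  apply/eqP; rewrite eqEsubset flag_orbit_subset.
  - have K0 : t0 M \in <<[set t0 M; t2 M]>> by rewrite mem_gen ?set21.
    have K2 : t2 M \in <<[set t0 M; t2 M]>> by rewrite mem_gen ?set22.
    by rewrite !subUset !sub1set orbit_refl -permM !apply_orbit ?groupM.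
  - by rewrite !inE eqxx.
  - move=> t u /set2P[] ->; rewrite !inE => /orP[] /orP[] /eqP ->;
    by rewrite -?t02C ?t0K ?t2K ?eqxx ?orbT.
have n0 u : t0 M u == u = false by apply: negPf; apply: t0_neq.
have n2 u : t2 M u == u = false by apply: negPf; apply: t2_neq.
have n02 u : t0 M u == t2 M u = false by apply: negPf; apply: pr.
have n020 : t0 M (t2 M w) == w = false.
  by rewrite -(inj_eq (@perm_inj _ (t0 M))) t0K eq_sym n02.
have dis : [disjoint [set w; t0 M w] & [set t2 M w; t0 M (t2 M w)]].
  rewrite disjoint_subset; apply/subsetP=> u /set2P[] ->; rewrite !inE negb_or.
    by rewrite !(eq_sym w) n2 n020.
  by rewrite n02 (inj_eq perm_inj) eq_sym n2.
have /eqP -> : #|[set w; t0 M w] :|: [set t2 M w; t0 M (t2 M w)]|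
    == (#|[set w; t0 M w]| + #|[set t2 M w; t0 M (t2 M w)]|)%N.
  by rewrite (leq_card_setU _ _).2.
by rewrite !cards2 !(eq_sym _ (t0 M _)) !n0.
Qed.

End Marked.

End Automorphisms.

(** * Behaviour under duality and twinness *)

Lemma dual_full_aut (M : cmap) (c : {perm flag M}) :
  (c \in full_aut (dual_map M)) = (c \in full_aut M).
Proof. by apply/(full_autP (M := dual_map M))/full_autP => -[]. Qed.

Lemma dual_colour_aut (M : cmap) : colour_aut (dual_map M) = colour_aut M.
Proof.
have dualP (c : {perm flag M}) : (c \in colour_aut (dual_map M)) = (c \in colour_aut M).
  apply/(colour_autP (M := dual_map M))/colour_autP => -[Fc sc];
  by split; rewrite // ?dual_full_aut // -dual_full_aut.
by apply/group_inj/setP => c; apply: dualP.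
Qed.

Lemma twin_colour_aut (M : cmap) : colour_aut (twin_map M) = colour_aut M.
Proof.
have twinP (c : {perm flag M}) : (c \in colour_aut (twin_map M)) = (c \in colour_aut M).
  apply/(colour_autP (M := twin_map M))/colour_autP => -[Fc sc]; split=> // x.
    by apply: negb_inj; have := sc x; rewrite !inE.
  by rewrite !inE sc.
by apply/group_inj/setP => c; apply: twinP.
Qed.

Lemma dual_edge_biregular (M : cmap) : edge_biregular M -> edge_biregular (dual_map M).
Proof.
move/edge_biregularP => tr; apply/edge_biregularP => x w sx sw.
by rewrite dual_colour_aut; apply: tr.
Qed.

Lemma twin_edge_biregular (M : cmap) : edge_biregular M -> edge_biregular (twin_map M).
Proof.
move/edge_biregularP => tr; apply/edge_biregularP => x w; rewrite !inE => sx sw.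
rewrite twin_colour_aut; have [||h Hh hx] := tr (t1 M x) (t1 M w); rewrite ?shaded_t1 //.
exists h => //; apply: (perm_inj (s := t1 M)).
by have /colour_autP[/full_autP[_ <- _] _] := Hh.
Qed.

Lemma dual_marked (M : cmap) (x : flag M) (r0 r2 rho0 rho2 : {perm flag M}) :
  marked x r0 r2 rho0 rho2 -> marked (M := dual_map M) x r2 r0 rho2 rho0.
Proof.
case=> sx [H0 H2 Hr0 Hr2] [e0 e2] [f0 f2].
by split; [exact: sx | rewrite dual_colour_aut; split | split | split].
Qed.

Lemma twin_marked (M : cmap) (x : flag M) (r0 r2 rho0 rho2 : {perm flag M}) :
  marked x r0 r2 rho0 rho2 -> marked (M := twin_map M) (t1 M x) rho0 rho2 r0 r2.
Proof.
case=> sx [H0 H2 Hr0 Hr2] [e0 e2] [f0 f2].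
split; [by rewrite inE shaded_t1 sx | by rewrite twin_colour_aut; split | by split |].
by rewrite /= t1K.
Qed.

(** * Map isomorphisms from matching generators *)

Section Isomorphism.

Variables M N : cmap.
Hypotheses (ebM : edge_biregular M) (ebN : edge_biregular N).
Variables (x : flag M) (r0 r2 rho0 rho2 : {perm flag M}).
Variables (y : flag N) (s0 s2 sigma0 sigma2 : {perm flag N}).
Hypotheses (mx : marked x r0 r2 rho0 rho2) (my : marked y s0 s2 sigma0 sigma2).

(** The isomorphism sends [h x] to [phi h y] and [h (t1 M x)] to [phi h (t1 N y)]; adjacency at the
    marked corner is expressed by the generators, which [phi] matches. *)
Lemma morphism_cmap_iso (phi : {morphism colour_aut M >-> {perm flag N}}) :
    #|colour_aut M| = #|colour_aut N| ->
    phi r0 = s0 -> phi r2 = s2 -> phi rho0 = sigma0 -> phi rho2 = sigma2 ->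
  cmap_iso M N.
Proof.
move=> oMN p0 p2 pr0 pr2.
have [sx [H0 H2 Hr0 Hr2] [e0 e2] [f0 f2]] := mx.
have [sy [K0 K2 Kr0 Kr2] [g0 g2] [k0 k2]] := my.
have phiH h : h \in colour_aut M -> phi h \in colour_aut N.
  move=> Hh; have: h \in phi @*^-1 colour_aut N; last by case/morphpreP.
  move: h Hh; apply/subsetP; rewrite {1}(marked_gen ebM mx).
  by apply: gen_set4P; apply/morphpreP; rewrite ?p0 ?p2 ?pr0 ?pr2.
(* The default 1 occurs only for unshaded [w], where [f] uses [lift (t1 M w)] instead. *)
pose lift w := odflt 1 [pick h in colour_aut M | h x == w].
have liftE h : h \in colour_aut M -> lift (h x) = h.
  move=> Hh; rewrite /lift; case: pickP => [k /andP[Kk /eqP kx] | /(_ h)] /=.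
    by apply: (full_aut_inj (x := x)); rewrite ?colour_aut_full.
  by rewrite Hh eqxx.
pose f w := if w \in shaded M then phi (lift w) y else t1 N (phi (lift (t1 M w)) y).
have fx h : h \in colour_aut M -> f (h x) = phi h y.
  by move=> Hh; have /colour_autP[_ hs] := Hh; rewrite /f hs sx liftE.
have fx1 h : h \in colour_aut M -> f (h (t1 M x)) = phi h (t1 N y).
  move=> Hh; have /colour_autP[/full_autP[_ h1 _] hs] := Hh.
  rewrite /f hs shaded_t1 sx /= -h1 t1K liftE //.
  by have /colour_autP[/full_autP[_ -> _] _] := phiH h Hh.
have step (s : {perm flag M}) (u : {perm flag N}) r rho :
    (forall h, h \in colour_aut M -> forall w, h (s w) = s (h w)) ->
    (forall h, h \in colour_aut N -> forall w, h (u w) = u (h w)) ->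
    r \in colour_aut M -> rho \in colour_aut M ->
    r x = s x -> rho (t1 M x) = s (t1 M x) ->
    phi r y = u y -> phi rho (t1 N y) = u (t1 N y) -> forall w, f (s w) = u (f w).
  move=> sC uC Hr Hrho rx rhox ry rhoy w.
  have [h Hh [] ->] := marked_flagP ebM mx w; rewrite -sC //.
    by rewrite -rx -permM !fx ?groupM // morphM // permM ry uC // phiH.
  by rewrite -rhox -permM !fx1 ?groupM // morphM // permM rhoy uC // phiH.
have f_t0 w : f (t0 M w) = t0 N (f w).
  apply: (step _ _ r0 rho0); rewrite ?p0 ?pr0 // => h /colour_autP[/full_autP[] //].
have f_t2 w : f (t2 M w) = t2 N (f w).
  apply: (step _ _ r2 rho2); rewrite ?p2 ?pr2 // => h /colour_autP[/full_autP[] //].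
have f_t1 w : f (t1 M w) = t1 N (f w).
  have [h Hh hw] := marked_flagP ebM mx w.
  have /colour_autP[/full_autP[_ h1 _] _] := Hh.
  have /colour_autP[/full_autP[_ p1 _] _] := phiH h Hh.
  by case: hw => ->; rewrite -h1 ?t1K ?fx ?fx1 // ?p1 ?t1K.
have f_sh w : (f w \in shaded N) = (w \in shaded M).
  have [h Hh hw] := marked_flagP ebM mx w.
  have /colour_autP[_ hs] := Hh; have /colour_autP[_ ps] := phiH h Hh.
  by case: hw => ->; rewrite ?fx ?fx1 // ps hs ?shaded_t1 sx sy.
exists f; split=> //.
have cardMN : #|flag M| = #|flag N|.
  by rewrite (marked_card_flag ebM mx) (marked_card_flag ebN my) oMN.
(* The image is closed under adjacency, hence everything; injectivity follows by counting flags. *)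
have f_surj v : v \in codom f.
  move: v; apply: (flag_connected (P := [in codom f]) (x := f x)); first exact: codom_f.
  by move=> _ /codomP[w ->]; rewrite -f_t0 -f_t1 -f_t2 !codom_f.
have f_inj : injective f.
  have /image_injP fI : #|codom f| == #|flag M|.
    by rewrite cardMN; apply/eqP/eq_card => v; rewrite f_surj.
  by move=> u v; apply: fI.
by apply: inj_card_bij; rewrite // cardMN.
Qed.

End Isomorphism.

(** * Colour reversal and full regularity *)

Lemma full_aut_colour (M : cmap) (g : {perm flag M}) : g \in full_aut M ->
  exists b, forall w, (g w \in shaded M) = b (+) (w \in shaded M).
Proof.
case/full_autP=> g0 g1 g2; have [x sx] := exists_shaded M.
exists (g x \notin shaded M) => w; apply/eqP; move: w.
apply: (flag_connected
  (P := fun w => (g w \in _) == (g x \notin shaded M) (+) (w \in shaded M)) (x := x)).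
  by rewrite sx addbT negbK.
move=> w /eqP e; rewrite g0 g1 g2 !shaded_t0 !shaded_t1 !shaded_t2 e.
by rewrite addbN !eqxx.
Qed.

Lemma full_aut_norm (M : cmap) (g h : {perm flag M}) :
  g \in full_aut M -> h \in colour_aut M -> h ^ g \in colour_aut M.
Proof.
move=> Fg /colour_autP[Fh hs]; apply/colour_autP; split; first by rewrite groupJ.
move=> w; have [b gs] := full_aut_colour Fg.
by rewrite -{2}[w](permKV g) conjgE !permM !gs hs.
Qed.

(** Such an isomorphism is a colour-reversing automorphism of [M]; it joins the two colour classes,
    on each of which [colour_aut M] is transitive. *)
Lemma twin_iso_fully_regular (M : cmap) :
  edge_biregular M -> cmap_iso M (twin_map M) -> fully_regular M.
Proof.
move=> /edge_biregularP tr [f [f_bij f0 f1 f2 fs]].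
pose g := perm (bij_inj f_bij).
have gE w : g w = f w by rewrite permE.
have Fg : g \in full_aut M.
  by apply/full_autP; split=> w; rewrite !gE ?f0 ?f1 ?f2.
have [x sx] := exists_shaded M.
have gx : f x \notin shaded M by have := fs x; rewrite inE sx.
apply/imsetP; exists x; rewrite ?inE //; apply/esym/setP=> w; rewrite inE.
apply/orbitP; have [sw | sw] := boolP (w \in shaded M).
  by have [h /colour_aut_full Hh hx] := tr x w sx sw; exists h.
have [||h /colour_aut_full Fh] := tr (t1 M (f x)) (t1 M w); rewrite ?shaded_t1 //.
have /full_autP[_ -> _] := Fh; move/perm_inj => hx.
by exists (g * h); rewrite ?groupM //= /aperm permM gE.
Qed.

(* A colour-reversing automorphism conjugates r0 to rho0. *)
Lemma fully_regular_conj (M : cmap) x r0 r2 rho0 rho2 :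
    marked x r0 r2 rho0 rho2 -> fully_regular M ->
  rho0 \in 'Z(colour_aut M) -> r0 \in 'Z(colour_aut M).
Proof.
case=> sx [H0 H2 Hr0 Hr2] [e0 e2] [f0 f2] fr /centerP[_ crho].
have [g Fg /= gx] := atransP2 fr (in_setT x) (in_setT (t1 M x)).
have r0g : r0 ^ g = rho0.
  have F0 := colour_aut_full H0; have Fr0 := colour_aut_full Hr0.
  apply: (full_aut_inj (x := t1 M x)) => //; first exact: groupJ.
  rewrite f0 gx /aperm conjgE !permM permK e0.
  by have /full_autP[-> _ _] := Fg.
apply/centerP; split=> // h Hh; apply: (conjg_inj g); rewrite !conjMg r0g.
exact/crho/full_aut_norm.
Qed.

(** * The map built from a group with four generating involutions *)

Section RegularMap.

Variables (gT : finGroupType) (r0 r2 rho0 rho2 : gT).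
Hypotheses (o0 : #[r0] = 2) (o2 : #[r2] = 2) (or0 : #[rho0] = 2) (or2 : #[rho2] = 2).
Hypotheses (cr : commute r0 r2) (crho : commute rho0 rho2).
Hypothesis gen : <<[set r0; r2; rho0; rho2]>> = [set: gT].

(* The flags of the map below are (g, true) and (g, false), the shaded and the *)
(* unshaded flag of the corner g.                                             *)
Definition side_fun (r rho : gT) (p : gT * bool) : gT * bool :=
  (p.1 * (if p.2 then r else rho), p.2).

Lemma side_funK r rho : #[r] = 2 -> #[rho] = 2 -> involutive (side_fun r rho).
Proof. by move=> or orho [g []]; rewrite /side_fun /= -mulgA order2K ?mulg1. Qed.

Definition reg_t0 : {perm gT * bool} := perm (can_inj (side_funK o0 or0)).
Definition reg_t2 : {perm gT * bool} := perm (can_inj (side_funK o2 or2)).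

Lemma reg_t1_funK : involutive (fun p : gT * bool => (p.1, ~~ p.2)).
Proof. by case=> g b; rewrite /= negbK. Qed.

Definition reg_t1 : {perm gT * bool} := perm (can_inj reg_t1_funK).

Lemma reg_t0K : involutive reg_t0.
Proof. by move=> p; rewrite !permE; apply: side_funK. Qed.
Lemma reg_t1K : involutive reg_t1.
Proof. by move=> p; rewrite !permE; apply: reg_t1_funK. Qed.
Lemma reg_t2K : involutive reg_t2.
Proof. by move=> p; rewrite !permE; apply: side_funK. Qed.

Lemma side_fun_neq r rho p : #[r] = 2 -> #[rho] = 2 -> side_fun r rho p != p.
Proof.
move=> or orho; case: p => g b; rewrite xpair_eqE /= negb_and -{2}[g]mulg1.
by rewrite (inj_eq (mulgI g)) -order_eq1; case: b; rewrite ?or ?orho.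
Qed.

Lemma reg_t0_neq p : reg_t0 p != p.
Proof. by rewrite permE side_fun_neq. Qed.
Lemma reg_t1_neq p : reg_t1 p != p.
Proof. by rewrite permE; case: p => g []; rewrite xpair_eqE andbF. Qed.
Lemma reg_t2_neq p : reg_t2 p != p.
Proof. by rewrite permE side_fun_neq. Qed.

Lemma reg_t02C p : reg_t0 (reg_t2 p) = reg_t2 (reg_t0 p).
Proof.
by rewrite !permE; case: p => g []; rewrite /side_fun /= -!mulgA ?cr ?crho.
Qed.

Lemma reg_trans : [transitive <<[set reg_t0; reg_t1; reg_t2]>>, on [set: gT * bool] | 'P].
Proof.
set T := [set _; _; _]; apply/imsetP; exists (1, true); rewrite ?inE //.
set O := orbit _ _ _.
have OT t p : t \in T -> p \in O -> t p \in O.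
  move=> Tt /orbitP[g Tg <-]; rewrite /= /aperm -permM.
  by apply: (mem_orbit 'P); rewrite groupM // mem_gen.
have O0 p : p \in O -> side_fun r0 rho0 p \in O.
  by move=> /(OT reg_t0); rewrite permE; apply; rewrite !inE eqxx.
have O1 p : p \in O -> (p.1, ~~ p.2) \in O.
  by move=> /(OT reg_t1); rewrite permE; apply; rewrite !inE eqxx orbT.
have O2 p : p \in O -> side_fun r2 rho2 p \in O.
  by move=> /(OT reg_t2); rewrite permE; apply; rewrite !inE eqxx orbT.
have Og u : (u, true) \in O.
  have : u \in <<[set r0; r2; rho0; rho2]>> by rewrite gen inE.
  case/gen_prodgP => n [c Rc ->]; elim: n c Rc => [|n IH] c Rc.
    by rewrite big_ord0 orbit_refl.
  rewrite big_ord_recr /=; set v := \prod_(i < n) _.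
  have Ov : (v, true) \in O by apply: IH => i; apply: Rc.
  have := Rc ord_max; rewrite !inE -!orbA => /or4P[] /eqP->.
  - exact: (O0 (v, true)).
  - exact: (O2 (v, true)).
  (* [rho0] acts on the unshaded flags only: pass there by [t1], apply [t0], and return. *)
  - exact: (O1 (_, false) (O0 (v, false) (O1 (v, true) Ov))).
  - exact: (O1 (_, false) (O2 (v, false) (O1 (v, true) Ov))).
apply/esym/setP => -[u []]; rewrite inE ?Og //.
exact: (O1 (u, true)).
Qed.

Definition reg_shaded : {set gT * bool} := [set p | p.2].

Lemma reg_shaded_t0 p : (reg_t0 p \in reg_shaded) = (p \in reg_shaded).
Proof. by rewrite permE !inE. Qed.
Lemma reg_shaded_t1 p : (reg_t1 p \in reg_shaded) = (p \notin reg_shaded).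
Proof. by rewrite permE !inE. Qed.
Lemma reg_shaded_t2 p : (reg_t2 p \in reg_shaded) = (p \in reg_shaded).
Proof. by rewrite permE !inE. Qed.

Definition reg_map : cmap :=
  CMap reg_t0K reg_t1K reg_t2K reg_t0_neq reg_t1_neq reg_t2_neq reg_t02C reg_trans
    reg_shaded_t0 reg_shaded_t2 reg_shaded_t1.

(* Permutations compose from left to right, hence the inverse of h. *)
Lemma left_mul_funK (h : gT) :
  cancel (fun p : gT * bool => (h^-1 * p.1, p.2)) (fun p => (h * p.1, p.2)).
Proof. by case=> g b; rewrite /= mulKVg. Qed.

Definition left_mul (h : gT) : {perm flag reg_map} := perm (can_inj (left_mul_funK h)).

Lemma left_mulM : {morph left_mul : h k / h * k}.
Proof.
move=> h k; apply/permP => p; rewrite permM !permE /=.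
by rewrite invMg mulgA.
Qed.

Canonical left_mul_morphism := Morphism (in2W left_mulM : {in [set: gT] &, _}).

Lemma left_mul_inj : 'injm left_mul_morphism.
Proof.
apply/injmP => h k _ _ /permP/(_ (1, true)); rewrite !permE /= !mulg1.
by case=> /invg_inj.
Qed.

Lemma left_mul_aut h : left_mul h \in colour_aut reg_map.
Proof.
apply/colour_autP; split; last by move=> p; rewrite permE !inE.
by apply/full_autP; split=> p; rewrite !permE /= ?permE /= /side_fun /= ?mulgA.
Qed.

(** A colour-preserving automorphism sends [(1, true)] to a shaded flag, as some left multiplication
    does, and one flag determines it. *)
Lemma left_mul_im : left_mul_morphism @* [set: gT] = colour_aut reg_map.
Proof.
apply/setP=> c; apply/morphimP/idP => [[h _ _ ->] | Hc]; first exact: left_mul_aut.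
have cx : c (1, true) = left_mul ((c (1, true)).1)^-1 (1, true).
  have /colour_autP[_ /(_ (1, true))] := Hc; rewrite permE /= invgK mulg1 !inE.
  by case: (c _) => u b /= ->.
exists ((c (1, true)).1)^-1; rewrite ?inE //.
by apply: full_aut_inj cx; rewrite colour_aut_full // left_mul_aut.
Qed.

Lemma reg_edge_biregular : edge_biregular reg_map.
Proof.
apply/edge_biregularP => -[u b] [v b']; rewrite !inE /= => -> ->.
exists (left_mul (u * v^-1)); first exact: left_mul_aut.
by rewrite permE /= invMg invgK mulgKV.
Qed.

Lemma reg_marked : marked (M := reg_map) (1, true)
  (left_mul r0) (left_mul r2) (left_mul rho0) (left_mul rho2).
Proof.
split; [by rewrite inE | by split; apply: left_mul_aut | split | split];
  by rewrite !permE /= ?permE /side_fun /= !mulg1 mul1g order2V.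
Qed.

Lemma left_mul_row i m : row_rel i m [set: gT] r0 r2 rho0 rho2 ->
  row_rel i m (colour_aut reg_map)
    (left_mul r0) (left_mul r2) (left_mul rho0) (left_mul rho2).
Proof.
have genL a b : [set: gT] = <<[set a; b]>> ->
    colour_aut reg_map = <<[set left_mul a; left_mul b]>> :> {set _}.
  move=> ab; have <- : left_mul_morphism @* <<[set a; b]>>
      = <<[set left_mul a; left_mul b]>>.
    by rewrite morphim_gen ?subsetT // morphimU !morphim_set1 ?inE.
  by rewrite -ab left_mul_im.
have LX h n : left_mul (h ^+ n) = left_mul h ^+ n.
  by apply: (morphX left_mul_morphism); rewrite inE.
by case: i => /= -[] *; split; rewrite -?left_mulM -?LX;
  first [exact: genL | congr left_mul].
Qed.

End RegularMap.

(** * Classification *)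

Lemma marked_exists (M : cmap) : edge_biregular M ->
  exists x r0 r2 rho0 rho2, marked (M := M) x r0 r2 rho0 rho2.
Proof.
move=> /edge_biregularP tr; have [x sx] := exists_shaded M.
have side w : w \in shaded M -> exists2 h, h \in colour_aut M & h x = w.
  exact: tr sx.
have side1 w : w \notin shaded M -> exists2 h, h \in colour_aut M & h (t1 M x) = w.
  move=> sw; have [|h Hh hx] := side (t1 M w); first by rewrite shaded_t1.
  by exists h => //; have /colour_autP[/full_autP[_ -> _] _] := Hh; rewrite hx t1K.
have [|r0 H0 e0] := side (t0 M x); rewrite ?shaded_t0 //.
have [|r2 H2 e2] := side (t2 M x); rewrite ?shaded_t2 //.
have [|rho0 Hr0 f0] := side1 (t0 M (t1 M x)); rewrite ?shaded_t0 ?shaded_t1 ?sx //.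
have [|rho2 Hr2 f2] := side1 (t2 M (t1 M x)); rewrite ?shaded_t2 ?shaded_t1 ?sx //.
by exists x, r0, r2, rho0, rho2.
Qed.

Lemma listed_dual (i : list_entry) m (M : cmap) x (r0 r2 rho0 rho2 : {perm flag M}) :
    edge_biregular M -> colour_aut M \isog 'D_(2 * m) -> marked x r0 r2 rho0 rho2 ->
    row_cond i m -> row_rel i m (colour_aut M) r2 r0 rho2 rho0 ->
  listed i m (dual_map M) r2 r0 rho2 rho0.
Proof.
move=> ebM iso mx ci rel; split; rewrite ?dual_colour_aut //.
  exact: dual_edge_biregular.
by apply/written_asP; exists x; apply: dual_marked.
Qed.

Lemma listed_twin (i : list_entry) m (M : cmap) x (r0 r2 rho0 rho2 : {perm flag M}) :
    edge_biregular M -> colour_aut M \isog 'D_(2 * m) -> marked x r0 r2 rho0 rho2 ->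
    row_cond i m -> row_rel i m (colour_aut M) rho0 rho2 r0 r2 ->
  listed i m (twin_map M) rho0 rho2 r0 r2.
Proof.
move=> ebM iso mx ci rel; split; rewrite ?twin_colour_aut //.
  exact: twin_edge_biregular.
by apply/written_asP; exists (t1 M x); apply: twin_marked.
Qed.

(** There are [m] edges, so a negative Euler characteristic becomes the inequality of
    [row_classification]. *)
Lemma dihedral_map_classification (M : cmap) m x (r0 r2 rho0 rho2 : {perm flag M}) :
    edge_biregular M -> proper_map M -> (euler M < 0)%R -> 1 < m ->
    colour_aut M \isog 'D_(2 * m) -> marked x r0 r2 rho0 rho2 ->
  [/\ ~~ odd m, 4 <= m & exists i : list_entry,
        [\/ listed i m M r0 r2 rho0 rho2,
            listed i m (dual_map M) r2 r0 rho2 rho0,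
            listed i m (twin_map M) rho0 rho2 r0 r2
          | listed i m (dual_map (twin_map M)) rho2 rho0 r2 r0]].
Proof.
move=> ebM prM eulerM m_gt1 iso mx.
have oH := card_isog_dihedral m_gt1 iso.
have [o0 o2 or0 or2] := marked_orders mx; have [cr crho] := marked_commutes mx.
have [nr nrho] := (marked_proper ebM mx).1 prM.
have eV := marked_vertices ebM mx; have eF := marked_faces ebM mx.
have eE := marked_edges ebM mx prM; rewrite oH in eV eF eE.
have VF : #|vertices M| + #|faces M| < m.
  move: eulerM eE; rewrite /euler; move: #|vertices M| #|edges M| #|faces M|.
  by clear => V E F; lia.
have [even_m m4 [i ci rel]] := row_classification m_gt1 iso o0 o2 or0 or2 cr crho nr
  nrho (marked_gen ebM mx) eV eF VF.
split=> //; exists i; case: rel => rel.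
- by constructor 1; split=> //; apply/written_asP; exists x.
- by constructor 2; apply: listed_dual mx ci rel.
- by constructor 3; apply: listed_twin mx ci rel.
constructor 4; apply: (listed_dual (M := twin_map M)) ci _.
- exact: twin_edge_biregular.
- by rewrite twin_colour_aut.
- exact: twin_marked mx.
by rewrite twin_colour_aut.
Qed.

Lemma listed_iso (i : list_entry) (m : nat) (M N : cmap)
    (r0 r2 rho0 rho2 : {perm flag M}) (s0 s2 sigma0 sigma2 : {perm flag N}) :
  listed i m M r0 r2 rho0 rho2 -> listed i m N s0 s2 sigma0 sigma2 -> cmap_iso M N.
Proof.
case=> ebM isoM /written_asP[x mx] ci relM [ebN isoN /written_asP[y my] _ relN].
have m_gt1 : 1 < m by case/and3P: ci => _ m4 _; apply: leq_trans m4.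
have oM := card_isog_dihedral m_gt1 isoM; have oN := card_isog_dihedral m_gt1 isoN.
have [o0 o2 or0 or2] := marked_orders mx; have [p0 p2 pr0 pr2] := marked_orders my.
have [phi [f0 f2 fr0 fr2]] := row_morphism oM oN relM relN o0 o2 or0 or2 p0 p2 pr0 pr2.
by apply: (morphism_cmap_iso ebM ebN mx my (phi := phi)); rewrite // oM oN.
Qed.

(** Swapping colours inverts the products in the relations, and their common half power is its own
    inverse. *)
Lemma row12_twin (gT : finGroupType) (H : {set gT}) i m r0 r2 rho0 rho2 :
    i = Row1 \/ i = Row2 -> #[r0] = 2 -> #[r2] = 2 -> #[rho0] = 2 -> #[rho2] = 2 ->
    commute r0 r2 ->
  row_rel i m H r0 r2 rho0 rho2 -> row_rel i m H rho0 rho2 r0 r2.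
Proof.
move=> i12 o0 o2 or0 or2 cr.
have zV : (r0 * r2)^-1 = r0 * r2 by rewrite invMg !order2V.
have swap (a b : gT) n : #[a] = 2 -> #[b] = 2 -> (b * a) ^+ n = (a * b) ^- n.
  by move=> oa ob; rewrite -expgVn invMg !order2V.
case: i12 => -> /= [H1 H2 e z1 z2].
  have Z1 : (rho0 * r0) ^+ (m %/ 2) = r0 * r2 by rewrite swap // -z1 -e zV.
  have Z2 : (rho2 * r2) ^+ (m %/ 2) = r0 * r2 by rewrite swap // -z2 -z1 -e zV.
  by split; rewrite ?Z1 ?Z2 // setUC.
have Z1 : (rho2 * r0) ^+ (m %/ 2) = r0 * r2 by rewrite swap // -z2 -z1 -e zV.
have Z2 : (rho0 * r2) ^+ (m %/ 2) = r0 * r2 by rewrite swap // -z1 -e zV.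
by split; rewrite ?Z1 ?Z2 // setUC.
Qed.

(** The twin satisfies the same row with the same [m], so [listed_iso] identifies it with [M]. *)
Lemma listed_fully_regular (i : list_entry) m (M : cmap)
    (r0 r2 rho0 rho2 : {perm flag M}) :
  i = Row1 \/ i = Row2 -> listed i m M r0 r2 rho0 rho2 -> fully_regular M.
Proof.
move=> i12 lM; have [ebM isoM /written_asP[x mx] ci relM] := lM.
have [o0 o2 or0 or2] := marked_orders mx; have [cr crho] := marked_commutes mx.
apply: twin_iso_fully_regular => //; apply: listed_iso lM _.
exact: listed_twin ebM isoM mx ci (row12_twin i12 o0 o2 or0 or2 cr relM).
Qed.

Lemma listed_parameters (i : list_entry) m (M : cmap) (r0 r2 rho0 rho2 : {perm flag M}) :
  listed i m M r0 r2 rho0 rho2 -> [/\ proper_map M, (euler M < 0)%R & row_data i m M].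
Proof.
move=> lM; have [ebM isoM /written_asP[x mx] ci relM] := lM.
have m_gt1 : 1 < m by case/and3P: ci => _ m4 _; apply: leq_trans m4.
have oH := card_isog_dihedral m_gt1 isoM.
have [o0 o2 or0 or2] := marked_orders mx; have [cr crho] := marked_commutes mx.
have [nr nrho kV kF] := row_orders oH ci relM o0 o2 or0 or2 cr crho.
have prM : proper_map M by apply/(marked_proper ebM mx).
have ty := marked_type ebM mx.
have eV := marked_vertices ebM mx; have eF := marked_faces ebM mx.
have eE := marked_edges ebM mx prM; rewrite kV kF oH in ty eV eF eE.
have reg12 := fun i12 => listed_fully_regular i12 lM.
have nreg34 : i = Row3 \/ i = Row4 -> ~ fully_regular M.
  move=> i34 fr; have [Zrho nZ0] := row34_centre oH ci relM o0 o2 or2 i34.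
  by case/negP: nZ0; apply: fully_regular_conj mx fr Zrho.
have /and3P[even_m m4 c4] := ci.
clear -ty eV eF eE reg12 nreg34 even_m m4 c4 prM.
rewrite /row_data /euler.
move: ty eV eF eE reg12 nreg34 c4.
move: #|vertices M| #|edges M| #|faces M| => V E F.
case: i => /= ty eV eF eE reg12 nreg34 c4.
- have [-> -> ->] : [/\ V = 1%N, F = 1%N & E = m] by split; nia.
  split=> //; first (by lia); split=> //; first (by lia).
  exact/reg12/or_introl.
- have [-> -> ->] : [/\ V = 2, F = 2 & E = m] by split; nia.
  (* [m = 4] is excluded because [m %/ 2] is odd; this makes [4 - m] negative. *)
  have m6 : 6 <= m by lia.
  split=> //; first (by lia); split=> //; first (by lia).
  exact/reg12/or_intror.
- have [-> -> ->] : [/\ V = 1%N, F = (m %/ 2)%N & E = m] by split; nia.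
  split=> //; first (by lia); split=> //; first (by lia).
  exact/nreg34/or_introl.
have [-> -> ->] : [/\ V = 2, F = (m %/ 2)%N & E = m] by split; nia.
have m6 : 6 <= m by lia.
split=> //; first (by lia); split=> //; first (by lia).
exact/nreg34/or_intror.
Qed.

Lemma listed_exists (i : list_entry) (m : nat) : row_cond i m ->
  exists (M : cmap) (r0 r2 rho0 rho2 : {perm flag M}), listed i m M r0 r2 rho0 rho2.
Proof.
move=> ci; have [r0 [r2 [rho0 [rho2 [[o0 o2 or0 or2] cr crho gen rel]]]]] :=
  row_group_exists ci.
exists (reg_map o0 o2 or0 or2 cr crho gen).
exists (left_mul o0 o2 or0 or2 cr crho gen r0),
  (left_mul o0 o2 or0 or2 cr crho gen r2).
exists (left_mul o0 o2 or0 or2 cr crho gen rho0),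
  (left_mul o0 o2 or0 or2 cr crho gen rho2).
split=> //.
- exact: reg_edge_biregular.
- rewrite -left_mul_im isog_sym; apply: sub_isog => //; exact: left_mul_inj.
- by apply/written_asP; exists (1, true); apply: reg_marked.
exact: left_mul_row.
Qed.

(* In order: every map of the class is in the list up to duality and         *)
(* twinness (1 < m is the range where 'D_(2 * m) is dihedral of order 2m, and *)
(* a proper map has more than two corners); every listed map is in the class *)
(* and has the stated parameters; every row occurs for every m meeting its   *)
(* condition; a row and m determine the coloured map up to isomorphism.      *)
Theorem mainTheorem1 :
  [/\ forall (M : cmap) (m : nat),
        edge_biregular M -> proper_map M -> (euler M < 0)%R ->
        1 < m -> colour_aut M \isog 'D_(2 * m) ->
        [/\ ~~ odd m, 4 <= m
          & forall r0 r2 rho0 rho2 : {perm flag M},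
            written_as M r0 r2 rho0 rho2 ->
            exists i : list_entry,
              [\/ listed i m M r0 r2 rho0 rho2,
                  listed i m (dual_map M) r2 r0 rho2 rho0,
                  listed i m (twin_map M) rho0 rho2 r0 r2
                | listed i m (dual_map (twin_map M)) rho2 rho0 r2 r0]],
      forall (i : list_entry) (m : nat) (M : cmap)
          (r0 r2 rho0 rho2 : {perm flag M}),
        listed i m M r0 r2 rho0 rho2 ->
        [/\ proper_map M, (euler M < 0)%R & row_data i m M],
      forall (i : list_entry) (m : nat), row_cond i m ->
        exists (M : cmap) (r0 r2 rho0 rho2 : {perm flag M}),
          listed i m M r0 r2 rho0 rho2
    & forall (i : list_entry) (m : nat) (M N : cmap)
          (r0 r2 rho0 rho2 : {perm flag M}) (s0 s2 sigma0 sigma2 : {perm flag N}),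
        listed i m M r0 r2 rho0 rho2 ->
        listed i m N s0 s2 sigma0 sigma2 ->
        cmap_iso M N].
Proof.
split.
- move=> M m ebM prM eulM m_gt1 iso.
  (* The claims on [m] precede the choice of a quadruple, so they are drawn from an arbitrary marked
     corner. *)
  have [x [r0 [r2 [rho0 [rho2 mx]]]]] := marked_exists ebM.
  have [even_m m4 _] := dihedral_map_classification ebM prM eulM m_gt1 iso mx.
  split=> // s0 s2 sigma0 sigma2 /written_asP[y my].
  by have [_ _] := dihedral_map_classification ebM prM eulM m_gt1 iso my.
- exact: listed_parameters.
- exact: listed_exists.
exact: listed_iso.
Qed.
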